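(* Let $\mathbf{k}$, $A$, $R$ be as in the context and let $V_\bullet$ be a finite-dimensional graded $\mathbf{k}$-vector space. Then the functor $\mathrm{Rep}_R(A,V_\bullet)$ from commutative $\mathbf{k}$-algebras to sets is represented by an affine scheme of finite type over $\mathbf{k}$, equipped with an action of the algebraic group $G_{V_\bullet}$ (by change of basis).
   Context: $\mathbf{k}$ is an algebraically closed field. $A=\bigoplus_{i\ge 0}A_i$ is a non-negatively graded (not necessarily commutative) $\mathbf{k}$-algebra that is module-finite over its center $Z(A)$, such that $Z(A)$ is a finitely generated $\mathbf{k}$-algebra and $A_0$ is finite dimensional over $\mathbf{k}$. $R\subset Z(A)$ is a graded polynomial subring (a polynomial ring over $\mathbf{k}$ on homogeneous variables, not necessarily standard graded) over which $A$ is module-finite. Unadorned tensor products are over $\mathbf{k}$. For a commutative $\mathbf{k}$-algebra $T$ (placed in degree $0$) put $A_T=T\otimes A$ and $R_T=T\otimes R\subset Z(A_T)$. A $T$-flat family of $V_\bullet$-framed graded MCM $A$-modules is a graded $A_T$-module $M$ together with an isomorphism $V_\bullet\otimes R_T\to M$ of graded $R_T$-modules (taken up to isomorphisms compatible with the framings); equivalently, a graded $A_T$-module structure on $V_\bullet\otimes R_T$ extending its $R_T$-module structure. The functor is $$\mathrm{Rep}_R(A,V_\bullet)(T)=\{T\text{-flat families of } V_\bullet\text{-framed graded MCM } A\text{-modules}\}.$$ $G_{V_\bullet}=\mathrm{Aut}_R(V_\bullet\otimes R)_0$ is the algebraic group of degree-preserving $R$-module automorphisms of the graded free $R$-module $V_\bullet\otimes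 R$; it acts on $\mathrm{Rep}_R(A,V_\bullet)$ by changing the framing. *)

(* Defs.v *)
From HB Require Import structures.
From mathcomp Require Import all_boot all_order all_algebra.
From mathcomp Require Import boolp.
From mathcomp Require Import mpoly.

Set Implicit Arguments.
Unset Strict Implicit.
Unset Printing Implicit Defensive.

Import GRing.Theory.
Local Open Scope ring_scope.
Local Open Scope quotient_scope.

(* Unital associative k-algebras, the zero algebra being allowed; [algType] and
   [comAlgType] exclude it, but the zero ring has to be a legitimate test ring
   and the coordinate ring of an empty scheme. The mixin stores the library's
   module mixin, so that the k-module underlying {mpoly k[n]} is definitionally
   the usual one. *)
HB.mixin Record isPzAlgebra (k : pzRingType) A of GRing.PzRing A := {
  pzalg_lmod : GRing.Nmodule_isLSemiModule k A;
  pzalg_scaleAl : forall (c : k) (x y : A),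
    GRing.Nmodule_isLSemiModule.scale pzalg_lmod c (x * y)
      = GRing.Nmodule_isLSemiModule.scale pzalg_lmod c x * y;
  pzalg_scaleAr : forall (c : k) (x y : A),
    GRing.Nmodule_isLSemiModule.scale pzalg_lmod c (x * y)
      = x * GRing.Nmodule_isLSemiModule.scale pzalg_lmod c y
}.

#[short(type="pzAlgType")]
HB.structure Definition PzAlgebra (k : pzRingType) :=
  {A of GRing.PzRing A & isPzAlgebra k A}.

#[short(type="comPzAlgType")]
HB.structure Definition ComPzAlgebra (k : pzRingType) :=
  {A of GRing.ComPzRing A & isPzAlgebra k A}.

HB.instance Definition _ (k : pzRingType) (A : pzAlgType k) :
  GRing.Nmodule_isLSemiModule k (PzAlgebra.sort A) := @pzalg_lmod k A.
Coercion PzAlgebra_sort__canonical__GRing_Lmodule : PzAlgebra.type >-> GRing.Lmodule.type.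
HB.instance Definition _ (k : pzRingType) (A : comPzAlgType k) :
  GRing.Nmodule_isLSemiModule k (ComPzAlgebra.sort A) := @pzalg_lmod k A.

HB.instance Definition _ (k : comNzRingType) (n : nat) :=
  isPzAlgebra.Build k {mpoly k[n]}
    (@scalerAl k {mpoly k[n]}) (@scalerAr k {mpoly k[n]}).

Lemma pzscalerAl (k : pzRingType) (A : pzAlgType k) (c : k) (x y : A) :
  c *: (x * y) = (c *: x) * y.
Proof. exact: pzalg_scaleAl. Qed.

Lemma pzscalerAr (k : pzRingType) (A : pzAlgType k) (c : k) (x y : A) :
  c *: (x * y) = x * (c *: y).
Proof. exact: pzalg_scaleAr. Qed.

Record alghom (k : pzRingType) (A B : pzAlgType k) := AlgHom {
  alghom_fun :> A -> B;
  alghom_linear : linear alghom_fun;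
  alghom_monoid : monoid_morphism alghom_fun
}.

HB.instance Definition _ k (A B : pzAlgType k) (f : alghom A B) :=
  GRing.isLinear.Build k A B *:%R (alghom_fun f) (alghom_linear f).
HB.instance Definition _ k (A B : pzAlgType k) (f : alghom A B) :=
  GRing.isMonoidMorphism.Build A B (alghom_fun f) (alghom_monoid f).

Lemma alghom_eq (k : pzRingType) (A B : pzAlgType k) (f g : alghom A B) :
  f =1 g -> f = g.
Proof.
case: f g => [f f1 f2] [g g1 g2] /= /funext efg; move: f1 f2 g1 g2.
by rewrite efg => f1 f2 g1 g2; congr AlgHom; exact: Prop_irrelevance.
Qed.

Section AlgHomComp.
Context (k : pzRingType) (A B C : pzAlgType k).

Fact idalg_linear : linear (@id A). Proof. by []. Qed.
Fact idalg_monoid : monoid_morphism (@id A). Proof. by []. Qed.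
Definition idalg : alghom A A := AlgHom idalg_linear idalg_monoid.

Variables (g : alghom B C) (f : alghom A B).
Fact compalg_linear : linear (g \o f).
Proof. by move=> c x y /=; rewrite !linearP. Qed.
Fact compalg_monoid : monoid_morphism (g \o f).
Proof. by split=> [|x y] /=; rewrite ?rmorph1 ?rmorphM. Qed.
Definition compalg : alghom A C := AlgHom compalg_linear compalg_monoid.
End AlgHomComp.
Arguments idalg {k} A.

(* S is the image of a polynomial ring in finitely many variables; for S the
   full set this says that A is a finitely generated (commutative) algebra. *)
Definition fin_gen_subalg (k : comNzRingType) (A : pzAlgType k) (S : A -> Prop) :=
  exists (n : nat) (h : alghom {mpoly k[n]} A),
    forall a, S a <-> exists p, h p = a.

Definition fin_gen_alg (k : comNzRingType) (A : pzAlgType k) :=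
  fin_gen_subalg (fun _ : A => True).

Definition central (A : pzRingType) (z : A) := forall a, z * a = a * z.

Definition module_finite (A : pzRingType) (S : A -> Prop) :=
  exists (m : nat) (e : 'I_m -> A), forall a, exists c : 'I_m -> A,
    (forall i, S (c i)) /\ a = \sum_i c i * e i.

Definition fin_dim (k : pzRingType) (U : lmodType k) (S : U -> Prop) :=
  exists (m : nat) (e : 'I_m -> U), forall u, S u ->
    exists c : 'I_m -> k, u = \sum_i c i *: e i.

(* U is the internal direct sum of the additive subgroups G d. *)
Record grading (U : zmodType) (G : int -> U -> Prop) : Prop := Grading {
  grading0 : forall d, G d 0;
  gradingB : forall d x y, G d x -> G d y -> G d (x - y);
  grading_span : forall x, exists (s : seq int) (c : int -> U),
    (forall d, G d (c d)) /\ x = \sum_(d <- s) c d;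
  grading_free : forall (s : seq int) (c : int -> U), uniq s ->
    (forall d, G d (c d)) -> \sum_(d <- s) c d = 0 -> {in s, forall d, c d = 0}
}.

Record graded_alg (k : pzRingType) (A : pzAlgType k) (G : int -> A -> Prop) :
    Prop := GradedAlg {
  graded_alg_grading : grading G;
  graded_algZ : forall d c a, G d a -> G d (c *: a);
  graded_alg1 : G 0 1;
  graded_algM : forall d e a b, G d a -> G e b -> G (d + e) (a * b)
}.

Definition concentrated0 (U : zmodType) (d : int) (x : U) := d = 0 \/ x = 0.

Section Tensor.
Context (k : comNzRingType) (U V : lmodType k).

Definition bilin (W : lmodType k) (f : U -> V -> W) :=
  (forall u, linear (f u)) /\ (forall v, linear (f^~ v)).

(* A formal sum of pure tensors is a list of pairs; two of them are equal in
   the tensor product iff no bilinear map separates them. *)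
Definition tens_rel (s t : seq (U * V)) := forall (W : lmodType k) (f : U -> V -> W),
  bilin f -> \sum_(p <- s) f p.1 p.2 = \sum_(p <- t) f p.1 p.2.

Definition tens_relb s t := `[< tens_rel s t >].

Fact tens_rel_equiv : equiv_class_of tens_relb.
Proof.
split.
- by move=> s; apply/asboolP.
- by move=> s t; apply/asboolP/asboolP => h W f bf; rewrite h.
- move=> t s u /asboolP h1 /asboolP h2; apply/asboolP => W f bf.
  by rewrite h1 // h2.
Qed.
Canonical tens_equiv := EquivRelPack tens_rel_equiv.

Definition tens : Type := {eq_quot tens_equiv}.
HB.instance Definition _ := Choice.on tens.
HB.instance Definition _ := Quotient.on tens.

Definition pure (u : U) (v : V) : tens := \pi_tens [:: (u, v)].

Lemma tensP (s t : seq (U * V)) : \pi_tens s = \pi_tens t <-> tens_rel s t.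
Proof. by split=> [/eqmodP/asboolP|h]; last exact/eqmodP/asboolP. Qed.

Definition tens_lift (W : lmodType k) (f : U -> V -> W) (x : tens) : W :=
  \sum_(p <- repr x) f p.1 p.2.

Lemma tens_lift_pi (W : lmodType k) (f : U -> V -> W) s : bilin f ->
  tens_lift f (\pi_tens s) = \sum_(p <- s) f p.1 p.2.
Proof. by move=> bf; rewrite /tens_lift; apply: (iffLR (tensP _ s)) => //; rewrite reprK. Qed.

Definition tens_add (x y : tens) : tens := \pi_tens (repr x ++ repr y).
Definition tens_scale (c : k) (x : tens) : tens :=
  \pi_tens [seq (c *: p.1, p.2) | p <- repr x].
Definition tens_opp : tens -> tens := tens_scale (-1).
Definition tens_zero : tens := \pi_tens [::].


Lemma tens_relP (x y : tens) : tens_rel (repr x) (repr y) -> x = y.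
Proof. by move=> h; rewrite -[x]reprK -[y]reprK; apply/tensP. Qed.

Lemma tens_eqP (x y : tens) :
  (forall (W : lmodType k) (f : U -> V -> W), bilin f ->
     tens_lift f x = tens_lift f y) -> x = y.
Proof. by move=> h; apply: tens_relP => W f; exact: h. Qed.

Section Lift.
Variables (W : lmodType k) (f : U -> V -> W).
Hypothesis bf : bilin f.

Lemma bilinDl u u' v : f (u + u') v = f u v + f u' v.
Proof. by have := bf.2 v 1 u u'; rewrite !scale1r. Qed.
Lemma bilinDr u v v' : f u (v + v') = f u v + f u v'.
Proof. by have := bf.1 u 1 v v'; rewrite !scale1r. Qed.
Lemma bilin0l v : f 0 v = 0.
Proof. by apply: (addIr (f 0 v)); rewrite -bilinDl !add0r. Qed.
Lemma bilin0r u : f u 0 = 0.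
Proof. by apply: (addIr (f u 0)); rewrite -bilinDr !add0r. Qed.
Lemma bilinZl c u v : f (c *: u) v = c *: f u v.
Proof. by have := bf.2 v c u 0; rewrite /= bilin0l !addr0. Qed.
Lemma bilinZr c u v : f u (c *: v) = c *: f u v.
Proof. by have := bf.1 u c v 0; rewrite /= bilin0r !addr0. Qed.

Lemma tens_lift_zero : tens_lift f tens_zero = 0.
Proof. by rewrite tens_lift_pi // big_nil. Qed.
Lemma tens_lift_add x y :
  tens_lift f (tens_add x y) = tens_lift f x + tens_lift f y.
Proof. by rewrite tens_lift_pi // big_cat. Qed.
Lemma tens_lift_scale c x :
  tens_lift f (tens_scale c x) = c *: tens_lift f x.
Proof.
rewrite tens_lift_pi // big_map scaler_sumr; apply: eq_bigr => p _.
by rewrite bilinZl.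
Qed.
Lemma tens_lift_pure u v : tens_lift f (pure u v) = f u v.
Proof. by rewrite tens_lift_pi // big_seq1. Qed.
End Lift.

Fact tens_addA : associative tens_add.
Proof. by move=> x y z; apply: tens_eqP => W f bf; rewrite !tens_lift_add // addrA. Qed.
Fact tens_addC : commutative tens_add.
Proof. by move=> x y; apply: tens_eqP => W f bf; rewrite !tens_lift_add // addrC. Qed.
Fact tens_add0 : left_id tens_zero tens_add.
Proof.
by move=> x; apply: tens_eqP => W f bf; rewrite tens_lift_add // tens_lift_zero // add0r.
Qed.
Fact tens_addN : left_inverse tens_zero tens_opp tens_add.
Proof.
move=> x; apply: tens_eqP => W f bf.
by rewrite tens_lift_add // tens_lift_zero // tens_lift_scale // scaleN1r addNr.
Qed.
HB.instance Definition _ :=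
  GRing.isZmodule.Build tens tens_addA tens_addC tens_add0 tens_addN.

Fact tens_scaleA a b (x : tens) : tens_scale a (tens_scale b x) = tens_scale (a * b) x.
Proof. by apply: tens_eqP => W f bf; rewrite !tens_lift_scale // scalerA. Qed.
Fact tens_scale1 : left_id 1 tens_scale.
Proof. by move=> x; apply: tens_eqP => W f bf; rewrite tens_lift_scale // scale1r. Qed.
Fact tens_scaleDr : right_distributive tens_scale +%R.
Proof.
move=> c x y; apply: tens_eqP => W f bf.
by rewrite !(tens_lift_scale, tens_lift_add) // scalerDr.
Qed.
Fact tens_scaleDl (x : tens) : {morph tens_scale^~ x : a b / a + b}.
Proof.
move=> a b; apply: tens_eqP => W f bf.
by rewrite !(tens_lift_scale, tens_lift_add) // scalerDl.
Qed.
HB.instance Definition _ :=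
  GRing.Zmodule_isLmodule.Build k tens tens_scaleA tens_scale1 tens_scaleDr tens_scaleDl.

Lemma tens_lift_linear (W : lmodType k) (f : U -> V -> W) :
  bilin f -> linear (tens_lift f).
Proof. by move=> bf c x y; rewrite tens_lift_add // tens_lift_scale. Qed.

Lemma pure_bilin : bilin pure.
Proof.
split=> [u c v v'|v c u u'] /=; apply: tens_eqP => W f bf.
- by rewrite tens_lift_linear // !tens_lift_pure // bilinDr // bilinZr.
- by rewrite tens_lift_linear // !tens_lift_pure // bilinDl // bilinZl.
Qed.

Lemma tens_repr (x : tens) : x = \sum_(p <- repr x) pure p.1 p.2.
Proof.
apply: tens_eqP => W f bf; rewrite {1}/tens_lift.
elim: (repr x) => [|p s IH]; first by rewrite !big_nil tens_lift_zero.
by rewrite !big_cons tens_lift_add // -IH tens_lift_pure.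
Qed.

Lemma tens_ind (P : tens -> Prop) :
  P 0 -> (forall x y, P x -> P y -> P (x + y)) -> (forall u v, P (pure u v)) ->
  forall x, P x.
Proof.
move=> P0 PD Pp x; rewrite [x]tens_repr.
by elim: (repr x) => [|p s IH]; rewrite ?big_nil // big_cons; apply: PD.
Qed.

Lemma tens_linear_eq (W : lmodType k) (f g : tens -> W) :
  linear f -> linear g -> (forall u v, f (pure u v) = g (pure u v)) -> f =1 g.
Proof.
move=> lf lg fg.
have l0 (h : tens -> W) : linear h -> h 0 = 0.
  by move=> lh; apply: (addIr (h 0)); have := lh 1 0 0; rewrite !scale1r !add0r.
apply: tens_ind => [|x y hx hy|u v]; [by rewrite !l0 | | exact: fg].
by have := lf 1 x y; have := lg 1 x y; rewrite !scale1r hx hy => -> ->.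
Qed.

Lemma tens_univ (W : lmodType k) (f : U -> V -> W) : bilin f ->
  exists! g : tens -> W, linear g /\ forall u v, g (pure u v) = f u v.
Proof.
move=> bf; exists (tens_lift f); split; last first.
  move=> g [lg gf]; apply/funext/tens_linear_eq => //; first exact: tens_lift_linear.
  by move=> u v; rewrite gf tens_lift_pure.
by split=> [|u v]; [exact: tens_lift_linear | exact: tens_lift_pure].
Qed.

(* Degree-d part of the tensor product of two graded modules. *)
Definition tens_deg (G : int -> U -> Prop) (H : int -> V -> Prop) (d : int)
    (x : tens) := exists s : seq (U * V), x = \sum_(p <- s) pure p.1 p.2 /\
  forall p, p \in s -> exists i j, [/\ G i p.1, H j p.2 & i + j = d].


Section TensDeg.
Variables (G : int -> U -> Prop) (H : int -> V -> Prop).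

Lemma tens_deg0 d : tens_deg G H d 0.
Proof. by exists [::]; rewrite big_nil; split. Qed.
Lemma tens_degD d x y :
  tens_deg G H d x -> tens_deg G H d y -> tens_deg G H d (x + y).
Proof.
move=> [s [-> hs]] [t [-> ht]]; exists (s ++ t); rewrite big_cat; split=> // p.
by rewrite mem_cat => /orP[/hs|/ht].
Qed.
Lemma tens_deg_pure i j u v : G i u -> H j v -> tens_deg G H (i + j) (pure u v).
Proof.
move=> Gu Hv; exists [:: (u, v)]; rewrite big_seq1; split=> // p.
by rewrite inE => /eqP ->; exists i, j.
Qed.
Lemma tens_deg_ind d (P : tens -> Prop) :
  P 0 -> (forall x y, P x -> P y -> P (x + y)) ->
  (forall i j u v, G i u -> H j v -> i + j = d -> P (pure u v)) ->
  forall x, tens_deg G H d x -> P x.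
Proof.
move=> P0 PD Pp x [s [-> hs]]; elim: s hs => [|p s IH] hs; first by rewrite big_nil.
rewrite big_cons; apply: PD; last by apply: IH => q qs; apply: hs; rewrite inE qs orbT.
by have [|i [j [Gp Hp e]]] := hs p; [rewrite mem_head | apply: (Pp i j)].
Qed.
End TensDeg.

End Tensor.
Arguments tens {k} U V.
Arguments pure {k U V} u v.

Section TensMap.
Context (k : comNzRingType) (U U' V V' : lmodType k).
Definition tens_map (f : U -> U') (g : V -> V') : tens U V -> tens U' V' :=
  tens_lift (fun u v => pure (f u) (g v)).

Variables (f : U -> U') (g : V -> V').
Hypotheses (lf : linear f) (lg : linear g).

Fact tens_map_bilin : bilin (fun u v => pure (f u) (g v)).
Proof.
split=> [u c v v'|v c u u'] /=.
- by rewrite lg (bilinDr (pure_bilin _ _)) (bilinZr (pure_bilin _ _)).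
- by rewrite lf (bilinDl (pure_bilin _ _)) (bilinZl (pure_bilin _ _)).
Qed.
Lemma tens_map_linear : linear (tens_map f g).
Proof. exact: tens_lift_linear tens_map_bilin. Qed.
Lemma tens_map_pure u v : tens_map f g (pure u v) = pure (f u) (g v).
Proof. exact: tens_lift_pure tens_map_bilin _ _. Qed.
End TensMap.

Lemma tens_deg_lift (k : comNzRingType) (U V W : lmodType k)
    (G : int -> U -> Prop) (H : int -> V -> Prop) (K : W -> Prop)
    (f : U -> V -> W) d :
  bilin f -> K 0 -> (forall x y, K x -> K y -> K (x + y)) ->
  (forall i j u v, G i u -> H j v -> i + j = d -> K (f u v)) ->
  forall x, tens_deg G H d x -> K (tens_lift f x).
Proof.
move=> bf K0 KD Kf; apply: tens_deg_ind => [|x y hx hy|i j u v hu hv e].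
- by rewrite [X in K X](tens_lift_zero bf).
- by rewrite [X in K X](tens_lift_add bf); apply: KD.
- by rewrite tens_lift_pure //; apply: (Kf i j).
Qed.

Section LinearFacts.
Context (k : pzRingType) (U V : lmodType k) (f : U -> V) (lf : linear f).
Lemma lin0 : f 0 = 0.
Proof. by rewrite -(subrr 0) (zmod_morphism_linear lf) subrr. Qed.
Lemma linD : {morph f : x y / x + y}.
Proof. by move=> x y; have := lf 1 x y; rewrite !scale1r. Qed.
Lemma linZ : scalable f.
Proof. exact: scalable_linear lf. Qed.
End LinearFacts.

Section TensAlg.
Context (k : comNzRingType) (A B : pzAlgType k).

Lemma mull_linear (C : pzAlgType k) (a : C) : linear (fun x : C => a * x).
Proof. by move=> c x y; rewrite mulrDr pzscalerAr. Qed.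
Lemma mulr_linear (C : pzAlgType k) (a : C) : linear (fun x : C => x * a).
Proof. by move=> c x y; rewrite mulrDl pzscalerAl. Qed.

(* (a (x) b)(a' (x) b') = aa' (x) bb' *)
Definition tens_mul (x y : tens A B) : tens A B :=
  tens_lift (fun (a : A) (b : B) =>
    tens_map (fun a' : A => a * a') (fun b' : B => b * b') y) x.

Let bp := @pure_bilin k A B.

Fact tens_mul_linr a b :
  linear (tens_map (fun a' : A => a * a') (fun b' : B => b * b')).
Proof. by apply: tens_map_linear; exact: mull_linear. Qed.

Fact tens_mul_bilin y : bilin (fun (a : A) (b : B) =>
  tens_map (fun a' : A => a * a') (fun b' : B => b * b') y).
Proof.
have lm := tens_mul_linr.
split=> [a|b] c u v /=; elim/tens_ind: y => [|x y hx hy|a' b'].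
- by rewrite !(lin0 (lm _ _)) scaler0 addr0.
- by rewrite !(linD (lm _ _)) hx hy scalerDr addrACA.
- rewrite !tens_map_pure; try exact: mull_linear.
  by rewrite mulrDl -pzscalerAl (bilinDr bp) (bilinZr bp).
- by rewrite !(lin0 (lm _ _)) scaler0 addr0.
- by rewrite !(linD (lm _ _)) hx hy scalerDr addrACA.
- rewrite !tens_map_pure; try exact: mull_linear.
  by rewrite mulrDl -pzscalerAl (bilinDl bp) (bilinZl bp).
Qed.

Fact tens_mul_pure a b a' b' :
  tens_mul (pure a b) (pure a' b') = pure (a * a') (b * b').
Proof.
rewrite /tens_mul tens_lift_pure; last exact: tens_mul_bilin.
by rewrite tens_map_pure //; exact: mull_linear.
Qed.

Fact tens_mull_linear y : linear (tens_mul^~ y).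
Proof. exact: tens_lift_linear (tens_mul_bilin y). Qed.

Fact tens_mulr_linear x : linear (tens_mul x).
Proof.
elim/tens_ind: x => [|x y hx hy|a b] c u v.
- by rewrite !(lin0 (tens_mull_linear _)) scaler0 addr0.
- by rewrite !(linD (tens_mull_linear _)) hx hy scalerDr addrACA.
- rewrite /tens_mul !tens_lift_pure; try exact: tens_mul_bilin.
  exact: tens_mul_linr.
Qed.

Fact tens_mulDl : left_distributive tens_mul +%R.
Proof. by move=> x y z; rewrite (linD (tens_mull_linear z)). Qed.
Fact tens_mulDr : right_distributive tens_mul +%R.
Proof. by move=> x y z; rewrite (linD (tens_mulr_linear x)). Qed.
Let tens_mul0l y : tens_mul 0 y = 0. Proof. exact: lin0 (tens_mull_linear y). Qed.
Let tens_mul0r x : tens_mul x 0 = 0. Proof. exact: lin0 (tens_mulr_linear x). Qed.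

Fact tens_mulA : associative tens_mul.
Proof.
move=> x y z; elim/tens_ind: x => [|x x' hx hx'|a b]; first by rewrite !tens_mul0l.
  by rewrite !tens_mulDl hx hx'.
elim/tens_ind: y => [|y y' hy hy'|a' b']; first by rewrite !(tens_mul0l, tens_mul0r).
  by rewrite !(tens_mulDl, tens_mulDr) hy hy'.
elim/tens_ind: z => [|z z' hz hz'|a'' b'']; first by rewrite !tens_mul0r.
  by rewrite !tens_mulDr hz hz'.
by rewrite !tens_mul_pure !mulrA.
Qed.
Fact tens_mul1l : left_id (pure (1 : A) (1 : B)) tens_mul.
Proof.
elim/tens_ind => [|x y hx hy|a b]; first by rewrite tens_mul0r.
  by rewrite tens_mulDr hx hy.
by rewrite tens_mul_pure !mul1r.
Qed.
Fact tens_mul1r : right_id (pure (1 : A) (1 : B)) tens_mul.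
Proof.
elim/tens_ind => [|x y hx hy|a b]; first by rewrite tens_mul0l.
  by rewrite tens_mulDl hx hy.
by rewrite tens_mul_pure !mulr1.
Qed.

HB.instance Definition _ := GRing.Zmodule_isPzRing.Build (tens A B)
  tens_mulA tens_mul1l tens_mul1r tens_mulDl tens_mulDr.

Fact tens_scaleAl (c : k) (x y : tens A B) : c *: (x * y) = (c *: x) * y.
Proof. by rewrite [RHS](linZ (tens_mull_linear y)). Qed.
Fact tens_scaleAr (c : k) (x y : tens A B) : c *: (x * y) = x * (c *: y).
Proof. by rewrite [RHS](linZ (tens_mulr_linear x)). Qed.
HB.instance Definition _ :=
  isPzAlgebra.Build k (tens A B) tens_scaleAl tens_scaleAr.

Lemma pureM a b a' b' :
  pure a b * pure a' b' = pure (a * a') (b * b') :> tens A B.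
Proof. exact: tens_mul_pure. Qed.
End TensAlg.

Section TensComAlg.
Context (k : comNzRingType) (A B : comPzAlgType k).
Fact tens_mulC : @commutative (tens A B) _ *%R.
Proof.
move=> x y; elim/tens_ind: x => [|x x' hx hx'|a b]; first by rewrite mul0r mulr0.
  by rewrite mulrDl mulrDr hx hx'.
elim/tens_ind: y => [|y y' hy hy'|a' b']; first by rewrite mul0r mulr0.
  by rewrite mulrDl mulrDr hy hy'.
by rewrite !pureM mulrC [b * _]mulrC.
Qed.
HB.instance Definition _ := GRing.PzRing_hasCommutativeMul.Build (tens A B) tens_mulC.
End TensComAlg.

Section TensAlgMap.
Context (k : comNzRingType) (A A' B B' : pzAlgType k).
Variables (f : alghom A A') (g : alghom B B').

Fact alghom_lin (C C' : pzAlgType k) (h : alghom C C') : linear h.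
Proof. exact: alghom_linear. Qed.
Fact tens_alg_linear : linear (tens_map f g).
Proof. by apply: tens_map_linear; exact: alghom_lin. Qed.
Fact tens_alg_monoid : monoid_morphism (tens_map f g).
Proof.
have l := tens_alg_linear; have lf := alghom_lin f; have lg := alghom_lin g.
split=> [|x y]; first by rewrite tens_map_pure // !rmorph1.
elim/tens_ind: x => [|x x' hx hx'|a b]; first by rewrite mul0r (lin0 l) mul0r.
  by rewrite mulrDl !(linD l) hx hx' mulrDl.
elim/tens_ind: y => [|y y' hy hy'|a' b']; first by rewrite mulr0 (lin0 l) mulr0.
  by rewrite mulrDr !(linD l) hy hy' mulrDr.
by rewrite pureM !tens_map_pure // pureM !rmorphM.
Qed.
Definition tens_alghom : alghom (tens A B) (tens A' B') :=
  AlgHom tens_alg_linear tens_alg_monoid.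
End TensAlgMap.

(* V (x)_k B as a B-module; an alias, since [tens V B] already is a k-module. *)
Definition baseExt (k : comNzRingType) (V : lmodType k) (B : comPzAlgType k) :
  Type := tens V B.

Section BaseExt.
Context (k : comNzRingType) (V : lmodType k) (B : comPzAlgType k).
HB.instance Definition _ := GRing.Zmodule.copy (baseExt V B) (tens V B).

Definition ext_scale (b : B) : tens V B -> tens V B :=
  tens_map (fun v : V => v) (fun s : B => b * s).

Fact ext_scale_linear b : linear (ext_scale b).
Proof. by apply: tens_map_linear => //; exact: mull_linear. Qed.
Fact ext_scale_pure b v s : ext_scale b (pure v s) = pure v (b * s).
Proof. by apply: tens_map_pure => //; exact: mull_linear. Qed.

Fact ext_scaleA a b (w : baseExt V B) :
  ext_scale a (ext_scale b w) = ext_scale (a * b) w.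
Proof.
elim/tens_ind: w => [|x y hx hy|v s]; first by rewrite !(lin0 (ext_scale_linear _)).
  by rewrite !(linD (ext_scale_linear _)) hx hy.
by rewrite !ext_scale_pure mulrA.
Qed.
Fact ext_scale1 : left_id 1 (ext_scale : B -> baseExt V B -> baseExt V B).
Proof.
elim/tens_ind => [|x y hx hy|v s]; first by rewrite !(lin0 (ext_scale_linear _)).
  by rewrite !(linD (ext_scale_linear _)) hx hy.
by rewrite !ext_scale_pure mul1r.
Qed.
Fact ext_scaleDr :
  right_distributive (ext_scale : B -> baseExt V B -> baseExt V B) +%R.
Proof. by move=> b x y; rewrite (linD (ext_scale_linear b)). Qed.
Fact ext_scaleDl (w : baseExt V B) :
  {morph (fun b => ext_scale b w : baseExt V B) : a b / a + b}.
Proof.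
move=> a b; elim/tens_ind: w => [|x y hx hy|v s].
- by rewrite !(lin0 (ext_scale_linear _)) addr0.
- by rewrite !(linD (ext_scale_linear _)) hx hy addrACA.
- by rewrite !ext_scale_pure mulrDl (bilinDr (pure_bilin V B)).
Qed.
HB.instance Definition _ := GRing.Zmodule_isLmodule.Build B (baseExt V B)
  ext_scaleA ext_scale1 ext_scaleDr ext_scaleDl.

Definition epure (v : V) (s : B) : baseExt V B := pure v s.

Lemma scale_epure (b : B) v s : b *: epure v s = epure v (b * s).
Proof. exact: ext_scale_pure. Qed.
Lemma scale_epure1 (b : B) v : epure v b = b *: epure v 1.
Proof. by rewrite scale_epure mulr1. Qed.

Lemma ext_scaleZ (c : k) (w : tens V B) :
  c *: w = (c *: (1 : B)) *: (w : baseExt V B) :> tens V B.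
Proof.
elim/tens_ind: w => [|x y hx hy|v s]; first by rewrite scaler0 [RHS]scaler0.
  by rewrite scalerDr [RHS]scalerDr hx hy.
by rewrite scale_epure -pzscalerAl mul1r /epure (bilinZr (pure_bilin V B)).
Qed.

Lemma baseExt_ind (P : baseExt V B -> Prop) :
  P 0 -> (forall x y, P x -> P y -> P (x + y)) -> (forall v s, P (epure v s)) ->
  forall x, P x.
Proof. exact: tens_ind. Qed.

Lemma baseExt_linear_eq (N : lmodType B) (f g : baseExt V B -> N) :
  linear f -> linear g -> (forall v, f (epure v 1) = g (epure v 1)) -> f =1 g.
Proof.
move=> lf lg fg; apply: baseExt_ind => [|x y hx hy|v s].
- by rewrite (lin0 lf) (lin0 lg).
- by rewrite (linD lf) (linD lg) hx hy.
- by rewrite scale_epure1 (linZ lf) (linZ lg) fg.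
Qed.
End BaseExt.

Record algFunctor (k : comNzRingType) := AlgFunctor {
  fobj :> comPzAlgType k -> Type;
  fmap : forall T T' : comPzAlgType k, alghom T T' -> fobj T -> fobj T';
  fmap_id : forall (T : comPzAlgType k) x, fmap (idalg T) x = x;
  fmap_comp : forall (T T' T'' : comPzAlgType k) (g : alghom T' T'')
    (f : alghom T T') x, fmap (compalg g f) x = fmap g (fmap f x)
}.

(* Phi is a natural isomorphism from F to Hom(B, -), the functor of points of
   Spec B. *)
Definition represents (k : comNzRingType) (F : algFunctor k) (B : comPzAlgType k)
    (Phi : forall T : comPzAlgType k, F T -> alghom B T) :=
  (forall T, bijective (Phi T)) /\
  (forall (T T' : comPzAlgType k) (f : alghom T T') (x : F T),
     Phi T' (fmap f x) = compalg f (Phi T x)).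

Record groupFunctor (k : comNzRingType) := GroupFunctor {
  gfunctor :> algFunctor k;
  gone : forall T, gfunctor T;
  gmul : forall T, gfunctor T -> gfunctor T -> gfunctor T;
  ginv : forall T, gfunctor T -> gfunctor T;
  gmulA : forall T, associative (@gmul T);
  gmul1 : forall T, left_id (gone T) (@gmul T);
  gmulV : forall T, left_inverse (gone T) (@ginv T) (@gmul T);
  gmul_nat : forall (T T' : comPzAlgType k) (f : alghom T T') g h,
    fmap f (gmul g h) = gmul (fmap f g) (fmap f h)
}.

Record group_action (k : comNzRingType) (G : groupFunctor k) (F : algFunctor k)
    (act : forall T, G T -> F T -> F T) : Prop := GroupAction {
  gact1 : forall T x, act T (gone G T) x = x;
  gactM : forall T g h x, act T (gmul g h) x = act T g (act T h x);
  gact_nat : forall (T T' : comPzAlgType k) (f : alghom T T') g x,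
    fmap f (act T g x) = act T' (fmap f g) (fmap f x)
}.

(* The action is the morphism of schemes Spec H x Spec B -> Spec B with
   comorphism rho, where Spec H and Spec B represent G and F. *)
Definition algebraic_action (k : comNzRingType) (G : groupFunctor k)
    (F : algFunctor k) (H B : comPzAlgType k)
    (Psi : forall T : comPzAlgType k, G T -> alghom H T)
    (Phi : forall T : comPzAlgType k, F T -> alghom B T)
    (act : forall T, G T -> F T -> F T) :=
  exists rho : alghom B (tens H B),
    forall (T : comPzAlgType k) (g : G T) (x : F T) (b : B),
      Phi T (act T g x) b
        = tens_lift (fun (h : H) (b' : B) => Psi T g h * Phi T x b') (rho b).

Section Framed.
Context (k : comNzRingType) (A : pzAlgType k) (degA : int -> A -> Prop).
Context (n : nat) (iota : alghom {mpoly k[n]} A).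
Context (V : lmodType k) (degV : int -> V -> Prop).

Local Notation R := {mpoly k[n]}.

(* R carries the grading induced from A *)
Definition degR (d : int) (p : R) := degA d (iota p).

Section Over.
Variable T : comPzAlgType k.
Definition AT : pzAlgType k := tens T A.
Definition RT : comPzAlgType k := tens T R.
Definition iotaT : alghom RT AT := tens_alghom (idalg T) iota.
Definition WT : lmodType RT := baseExt V RT.

Definition degAT : int -> AT -> Prop := tens_deg (@concentrated0 T) degA.
Definition degRT : int -> RT -> Prop := tens_deg (@concentrated0 T) degR.
Definition degWT : int -> WT -> Prop := tens_deg degV degRT.

(* mu is a graded A_T-module structure on V (x) R_T extending its R_T-module
   structure *)
Record framed_action (mu : AT -> WT -> WT) : Prop := FramedAction {
  fact1 : forall w, mu 1 w = w;
  factM : forall a b w, mu (a * b) w = mu a (mu b w);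
  factDl : forall a b w, mu (a + b) w = mu a w + mu b w;
  factDr : forall a w w', mu a (w + w') = mu a w + mu a w';
  fact_extends : forall r w, mu (iotaT r) w = r *: w;
  fact_graded : forall d e a w, degAT d a -> degWT e w -> degWT (d + e) (mu a w)
}.

Definition rep := {mu : AT -> WT -> WT | framed_action mu}.

(* a degree-preserving automorphism together with its inverse *)
Record graded_aut (gh : (WT -> WT) * (WT -> WT)) : Prop := GradedAut {
  gaut_linear : linear gh.1;
  gaut_graded : forall d w, degWT d w -> degWT d (gh.1 w);
  gaut_linearV : linear gh.2;
  gaut_gradedV : forall d w, degWT d w -> degWT d (gh.2 w);
  gautK : cancel gh.1 gh.2;
  gautVK : cancel gh.2 gh.1
}.

Definition gaut := {gh : (WT -> WT) * (WT -> WT) | graded_aut gh}.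

End Over.

Lemma rep_eq T (x y : rep T) :
  (forall a w, sval x a w = sval y a w) -> x = y.
Proof.
case: x y => [mu hmu] [nu hnu] /= h; apply: eq_exist => /=.
by apply/funext => a; apply/funext => w.
Qed.

Lemma gaut_eq T (x y : gaut T) :
  (forall w, (sval x).1 w = (sval y).1 w) -> x = y.
Proof.
case: x y => [[g g'] hg] [[h h'] hh] /= e; apply: eq_exist.
have eg : g = h by apply/funext.
congr pair => //; apply/funext => w.
by rewrite -[w in LHS](gautVK hh w) /= -eg; exact: (gautK hg).
Qed.

Section BaseChange.
Variables (T T' : comPzAlgType k) (f : alghom T T').

Definition Af : alghom (AT T) (AT T') := tens_alghom f (idalg A).
Definition Rf : alghom (RT T) (RT T') := tens_alghom f (idalg R).
Definition Wf : WT T -> WT T' := tens_map (fun v : V => v) Rf.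

Fact Wf_linear : linear (Wf : tens V (RT T) -> tens V (RT T')).
Proof. by apply: tens_map_linear => //; exact: alghom_lin. Qed.
Lemma WfD w w' : Wf (w + w') = Wf w + Wf w'.
Proof. exact: linD Wf_linear w w'. Qed.
Lemma Wf0 : Wf 0 = 0. Proof. exact: lin0 Wf_linear. Qed.
Lemma Wf_pure v r : Wf (epure v r) = epure v (Rf r).
Proof. by apply: tens_map_pure => //; exact: alghom_lin. Qed.
Lemma WfZ (r : RT T) w : Wf (r *: w) = Rf r *: Wf w.
Proof.
elim/baseExt_ind: w => [|x y hx hy|v s]; first by rewrite scaler0 Wf0 scaler0.
  by rewrite scalerDr !WfD hx hy scalerDr.
by rewrite scale_epure !Wf_pure scale_epure rmorphM.
Qed.

(* The base change along f of an R_T-linear endomorphism of V (x) R_T: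
   v (x) s is sent to s . (image of phi (v (x) 1)). *)
Definition bc (phi : WT T -> WT T) : WT T' -> WT T' :=
  tens_lift (fun (v : V) (s : RT T') =>
    (s *: Wf (phi (epure v 1)) : baseExt V (RT T')) : tens V (RT T')).

Lemma Rf_scale1 (c : k) : Rf (c *: (1 : RT T)) = c *: (1 : RT T').
Proof. by rewrite linearZ rmorph1. Qed.

Lemma epureD (B : comPzAlgType k) (u v : V) (s : B) : epure (u + v) s = epure u s + epure v s.
Proof. exact: bilinDl (pure_bilin V B) u v s. Qed.
Lemma epureZ (B : comPzAlgType k) (c : k) (v : V) (s : B) :
  epure (c *: v) s = (c *: (1 : B)) *: epure v s.
Proof. by rewrite /epure (bilinZl (pure_bilin V B)) ext_scaleZ. Qed.

Section Linear.
Variable (phi : WT T -> WT T).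
Hypothesis lphi : linear phi.

Fact bc_bilin : bilin (fun (v : V) (s : RT T') =>
    (s *: Wf (phi (epure v 1)) : baseExt V (RT T')) : tens V (RT T')).
Proof.
split=> [v|s] c x y /=.
- rewrite [LHS]scalerDl; congr (_ + _).
  by rewrite [RHS]ext_scaleZ scalerA -pzscalerAl mul1r.
- rewrite epureD epureZ (linD lphi) (linZ lphi) WfD WfZ Rf_scale1 [LHS]scalerDr.
  by congr (_ + _); rewrite [RHS]ext_scaleZ !scalerA mulrC.
Qed.

Lemma bc_pure v s : bc phi (epure v s) = s *: Wf (phi (epure v 1)).
Proof. exact: tens_lift_pure bc_bilin v s. Qed.
Lemma bcD w w' : bc phi (w + w') = bc phi w + bc phi w'.
Proof. exact: linD (tens_lift_linear bc_bilin) w w'. Qed.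
Lemma bc0 : bc phi 0 = 0.
Proof. exact: lin0 (tens_lift_linear bc_bilin). Qed.
Lemma bcZ (s : RT T') w : bc phi (s *: w) = s *: bc phi w.
Proof.
elim/baseExt_ind: w => [|x y hx hy|v r]; first by rewrite scaler0 bc0 scaler0.
  by rewrite scalerDr !bcD hx hy scalerDr.
by rewrite scale_epure !bc_pure scalerA.
Qed.
Lemma bc_linear : linear (bc phi).
Proof. by move=> s w w'; rewrite bcD bcZ. Qed.

Lemma bc_Wf w : bc phi (Wf w) = Wf (phi w).
Proof.
elim/baseExt_ind: w => [|x y hx hy|v r]; first by rewrite (lin0 lphi) !Wf0 bc0.
  by rewrite (linD lphi) !WfD bcD hx hy.
by rewrite Wf_pure bc_pure -WfZ -(linZ lphi) -scale_epure1.
Qed.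
End Linear.

(* V (x) R_T' is spanned over R_T' by the image of V (x) R_T. *)
Lemma linear_Wf_eq (N : lmodType (RT T')) (g h : WT T' -> N) :
  linear g -> linear h -> (forall w, g (Wf w) = h (Wf w)) -> g =1 h.
Proof.
move=> lg lh e; apply: baseExt_linear_eq => // v.
by have := e (epure v 1); rewrite Wf_pure rmorph1.
Qed.
End BaseChange.

Lemma degRfP (T T' : comPzAlgType k) (f : alghom T T') d r :
  degRT d r -> degRT d (Rf f r).
Proof.
apply: tens_deg_lift; [| exact: tens_deg0 | exact: tens_degD |].
  by apply: tens_map_bilin; exact: alghom_lin.
move=> i j t p [->|->] hp <-; apply: tens_deg_pure => //; first by left.
by right; rewrite (lin0 (alghom_lin f)).
Qed.

Lemma degWfP (T T' : comPzAlgType k) (f : alghom T T') d w :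
  degWT d w -> degWT d (Wf f w).
Proof.
apply: tens_deg_lift; [| exact: tens_deg0 | exact: tens_degD |].
  by apply: tens_map_bilin => //; exact: alghom_lin.
by move=> i j v r hv hr <-; apply: tens_deg_pure => //; exact: degRfP.
Qed.

Hypothesis grA : graded_alg degA.
Hypothesis iotaC : forall p, central (iota p).

Lemma degR1 : degR 0 1.
Proof. by rewrite /degR rmorph1; exact: graded_alg1 grA. Qed.
Lemma degRM d e p q : degR d p -> degR e q -> degR (d + e) (p * q).
Proof. by rewrite /degR rmorphM; exact: graded_algM grA _ _ _ _. Qed.

Section Over2.
Variable T : comPzAlgType k.

Lemma concM d e (t t' : T) :
  concentrated0 d t -> concentrated0 e t' -> concentrated0 (d + e) (t * t').
Proof.
case=> [->|->]; last by right; rewrite mul0r.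
by case=> [->|->]; [left; rewrite addr0 | right; rewrite mulr0].
Qed.
Lemma degRT1 : degRT 0 (1 : RT T).
Proof. by rewrite -(addr0 0); apply: tens_deg_pure; [left | exact: degR1]. Qed.
Lemma degRT_pure1 (t : T) : degRT 0 (pure t (1 : R) : RT T).
Proof. by rewrite -(addr0 0); apply: tens_deg_pure; [left | exact: degR1]. Qed.
Lemma degRTM d e (r s : RT T) : degRT d r -> degRT e s -> degRT (d + e) (r * s).
Proof.
move=> hr hs; move: r hr; apply: tens_deg_ind => [|x y hx hy|i j t p ht hp <-].
- by rewrite mul0r; exact: tens_deg0.
- by rewrite mulrDl; apply: tens_degD.
move: s hs; apply: tens_deg_ind => [|x y hx hy|i' j' t' p' ht' hp' <-].
- by rewrite mulr0; exact: tens_deg0.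
- by rewrite mulrDr; apply: tens_degD.
by rewrite pureM addrACA; apply: tens_deg_pure; [exact: concM | exact: degRM].
Qed.
Lemma degWTZ d e (r : RT T) (w : WT T) : degRT d r -> degWT e w -> degWT (d + e) (r *: w).
Proof.
move=> hr; move: w; apply: tens_deg_ind => [|x y hx hy|i j v s hv hs <-].
- by rewrite [X in degWT _ X]scaler0; exact: tens_deg0.
- by rewrite [X in degWT _ X]scalerDr; apply: tens_degD.
rewrite [X in degWT _ X]scale_epure addrCA; apply: tens_deg_pure => //.
exact: degRTM.
Qed.
Lemma degWT_pure1 d v : degV d v -> degWT d (epure v (1 : RT T)).
Proof. by move=> hv; rewrite -[d]addr0; apply: tens_deg_pure => //; exact: degRT1. Qed.
End Over2.

Lemma bc_graded (T T' : comPzAlgType k) (f : alghom T T') (phi : WT T -> WT T) d :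
  linear phi -> (forall e w, degWT e w -> degWT (d + e) (phi w)) ->
  forall e w, degWT e w -> degWT (d + e) (bc f phi w).
Proof.
move=> lphi gphi e; apply: tens_deg_lift; [exact: bc_bilin | exact: tens_deg0 | exact: tens_degD |].
move=> i j v s hv hs <-; rewrite addrA addrC; apply: degWTZ => //.
by apply: degWfP; apply: gphi; exact: degWT_pure1.
Qed.

Lemma bc_id (T T' : comPzAlgType k) (f : alghom T T') : bc f (@id (WT T)) =1 id.
Proof.
apply: (linear_Wf_eq (f := f)) => [||w]; [exact: bc_linear | by [] | exact: bc_Wf].
Qed.

Lemma bc_comp (T T' : comPzAlgType k) (f : alghom T T') (phi psi : WT T -> WT T) :
  linear phi -> linear psi -> bc f (phi \o psi) =1 bc f phi \o bc f psi.
Proof.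
move=> lphi lpsi; have lc : linear (phi \o psi) by move=> r x y /=; rewrite lpsi lphi.
have lb := bc_linear f lphi; have lb' := bc_linear f lpsi.
apply: (linear_Wf_eq (f := f)) => [||w]; first exact: bc_linear.
  by move=> r x y /=; rewrite lb' lb.
by rewrite bc_Wf //= !bc_Wf.
Qed.

Section ActLinear.
Variables (T : comPzAlgType k) (mu : AT T -> WT T -> WT T).
Hypothesis hmu : framed_action mu.

Lemma iotaT_central r a : iotaT T r * a = a * iotaT T r.
Proof.
have li := alghom_lin (iotaT T).
elim/tens_ind: r => [|x y hx hy|t p]; first by rewrite (lin0 li) mul0r mulr0.
  by rewrite (linD li) mulrDl mulrDr hx hy.
elim/tens_ind: a => [|x y hx hy|t' a]; first by rewrite mul0r mulr0.
  by rewrite mulrDl mulrDr hx hy.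
rewrite /iotaT /= tens_map_pure //; last exact: alghom_lin.
by rewrite !pureM mulrC iotaC.
Qed.

Lemma fact_linear a : linear (mu a).
Proof.
move=> r w w'; rewrite (factDr hmu) -!(fact_extends hmu) -!(factM hmu).
by rewrite iotaT_central.
Qed.

Lemma iotaT_pure1 t : iotaT T (pure t (1 : R)) = pure t (1 : A).
Proof.
by rewrite /iotaT /= tens_map_pure ?rmorph1 //; exact: alghom_lin.
Qed.
Lemma fact_pure t a w : mu (pure t a) w = (pure t (1 : R) : RT T) *: mu (pure (1 : T) a) w.
Proof.
by rewrite -(fact_extends hmu) -(factM hmu) iotaT_pure1 pureM mulr1 mul1r.
Qed.
End ActLinear.

(* The base change along f of an A_T-module structure on V (x) R_T: t (x) a acts
   as t times the base change of the R_T-linear operator 1 (x) a. *)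
Section ActBaseChange.
Variables (T T' : comPzAlgType k) (f : alghom T T').

Definition bc_action (mu : AT T -> WT T -> WT T) (a : AT T') (w : WT T') : WT T' :=
  tens_lift (fun (t : T') (a0 : A) =>
    ((pure t (1 : R) : RT T') *: bc f (mu (pure (1 : T) a0)) w : baseExt V (RT T'))
      : tens V (RT T')) a.

Variable mu : AT T -> WT T -> WT T.
Hypothesis hmu : framed_action mu.

Let lmu a := fact_linear hmu a.

Lemma bcDphi a b w : bc f (mu (a + b)) w = bc f (mu a) w + bc f (mu b) w.
Proof.
move: w; apply: (linear_Wf_eq (f := f)) => [||w].
- exact/bc_linear/lmu.
- by move=> r x y; rewrite !(bc_linear f (lmu _)) scalerDr addrACA.
- by rewrite !bc_Wf ?(factDl hmu) ?WfD.
Qed.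
Lemma bcM a b w : bc f (mu (a * b)) w = bc f (mu a) (bc f (mu b) w).
Proof.
rewrite -[RHS](bc_comp f (lmu a) (lmu b)); congr (bc f _ w).
by apply/funext => x /=; rewrite (factM hmu).
Qed.
Lemma bc_iotaT r w : bc f (mu (iotaT T r)) w = Rf f r *: w.
Proof.
move: w; apply: (linear_Wf_eq (f := f)) => [||w]; first exact/bc_linear/lmu.
- by move=> s x y; rewrite scalerDr !scalerA mulrC.
- by rewrite bc_Wf // (fact_extends hmu) WfZ.
Qed.

Fact bc_action_bilin w : bilin (fun (t : T') (a0 : A) =>
    ((pure t (1 : R) : RT T') *: bc f (mu (pure (1 : T) a0)) w : baseExt V (RT T'))
      : tens V (RT T')).
Proof.
split=> [t|a] c x y /=.
- rewrite (bilinDr (pure_bilin T A)) bcDphi [LHS]scalerDr; congr (_ + _).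
  rewrite [RHS]ext_scaleZ scalerA -pzscalerAl mul1r.
  have -> : pure (1 : T) (c *: x) = iotaT T (c *: (1 : RT T)) * pure (1 : T) x.
    by rewrite linearZ rmorph1 -pzscalerAl mul1r (bilinZr (pure_bilin T A)).
  by rewrite bcM bc_iotaT scalerA linearZ rmorph1 -pzscalerAr mulr1.
- rewrite (bilinDl (pure_bilin T' R)) [LHS]scalerDl; congr (_ + _).
  by rewrite [RHS]ext_scaleZ scalerA -pzscalerAl mul1r (bilinZl (pure_bilin T' R)).
Qed.

Lemma bc_action_pure t a w :
  bc_action mu (pure t a) w = (pure t (1 : R) : RT T') *: bc f (mu (pure (1 : T) a)) w.
Proof. exact: tens_lift_pure (bc_action_bilin w) t a. Qed.
Lemma bc_actionDl a b w :
  bc_action mu (a + b) w = bc_action mu a w + bc_action mu b w.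
Proof. exact: linD (tens_lift_linear (bc_action_bilin w)) a b. Qed.
Lemma bc_action0l w : bc_action mu 0 w = 0.
Proof. exact: lin0 (tens_lift_linear (bc_action_bilin w)). Qed.

Lemma bc_action_linear a : linear (bc_action mu a).
Proof.
elim/tens_ind: a => [|x y hx hy|t a] r w w'.
- by rewrite !bc_action0l scaler0 addr0.
- by rewrite !bc_actionDl hx hy scalerDr addrACA.
- by rewrite !bc_action_pure (bc_linear f (lmu _)) scalerDr !scalerA mulrC.
Qed.

Lemma bc_action_Wf a w : bc_action mu (Af f a) (Wf f w) = Wf f (mu a w).
Proof.
have lA := alghom_lin (Af f).
elim/tens_ind: a => [|x y hx hy|t a].
- rewrite (lin0 lA) bc_action0l.
  by have := fact_extends hmu 0 w; rewrite rmorph0 scale0r => ->; rewrite Wf0.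
- by rewrite (linD lA) bc_actionDl hx hy (factDl hmu) WfD.
- rewrite /Af /= tens_map_pure //; last exact: alghom_lin.
  rewrite bc_action_pure bc_Wf // (fact_pure hmu) WfZ; congr (_ *: _).
  by rewrite /Rf /= tens_map_pure //; exact: alghom_lin.
Qed.

Lemma bc_actionP : framed_action (bc_action mu).
Proof.
have E a (t : T') : (pure t (1 : A) : AT T') * pure (1 : T') a = pure t a.
  by rewrite pureM mulr1 mul1r.
split.
- move=> w; rewrite bc_action_pure.
  have -> : bc f (mu (pure (1 : T) (1 : A))) w = w.
    rewrite -[RHS](bc_id f); congr (bc f _ w).
    by apply/funext => x; exact: (fact1 hmu).
  exact: scale1r.
- move=> a b w; elim/tens_ind: a => [|x y hx hy|t a].
  + by rewrite mul0r !bc_action0l.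
  + by rewrite mulrDl !bc_actionDl hx hy.
  elim/tens_ind: b => [|x y hx hy|t' b].
  + by rewrite mulr0 bc_action0l (lin0 (bc_action_linear _)).
  + by rewrite mulrDr !bc_actionDl hx hy (linD (bc_action_linear _)).
  rewrite pureM !bc_action_pure (linZ (bc_linear f (lmu _))) scalerA pureM mulr1.
  congr (_ *: _); rewrite -bcM; congr (bc f (mu _) w).
  by rewrite pureM mulr1.
- exact: bc_actionDl.
- by move=> a w w'; rewrite (linD (bc_action_linear a)).
- move=> r w; elim/tens_ind: r => [|x y hx hy|t p].
  + by rewrite rmorph0 bc_action0l scale0r.
  + by rewrite rmorphD bc_actionDl hx hy scalerDl.
  rewrite /iotaT /= tens_map_pure //; last exact: alghom_lin.
  rewrite bc_action_pure.
  have -> : pure (1 : T) (iota p) = iotaT T (pure (1 : T) p).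
    by rewrite /iotaT /= tens_map_pure //; exact: alghom_lin.
  rewrite bc_iotaT scalerA /Rf /= tens_map_pure //; last exact: alghom_lin.
  by rewrite rmorph1 pureM mulr1 mul1r.
- move=> d e a w ha hw; move: a ha.
  apply: tens_deg_lift; [exact: bc_action_bilin | exact: tens_deg0 | exact: tens_degD |].
  move=> i j t a [->|->] ha <-; last first.
    rewrite (bilin0l (pure_bilin T' R)) [X in degWT _ X]scale0r; exact: tens_deg0.
  rewrite add0r -[j + e]add0r; apply: degWTZ; first exact: degRT_pure1.
  apply: bc_graded => // e' w' hw'; apply: (fact_graded hmu) => //.
  by rewrite -[j]add0r; apply: tens_deg_pure => //; left.
Qed.

(* It is the only A_T'-module structure on V (x) R_T' compatible with mu. *)
Lemma bc_action_unique nu : framed_action nu ->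
  (forall a w, nu (Af f a) (Wf f w) = Wf f (mu a w)) ->
  forall a w, nu a w = bc_action mu a w.
Proof.
move=> hnu e; elim/tens_ind => [|x y hx hy|t a] w.
- by have := fact_extends hnu 0 w; rewrite rmorph0 scale0r bc_action0l => ->.
- by rewrite (factDl hnu) hx hy bc_actionDl.
rewrite (fact_pure hnu) bc_action_pure; congr (_ *: _); move: w.
apply: (linear_Wf_eq (f := f)) => [||w]; [exact: fact_linear | exact: bc_linear |].
rewrite bc_Wf // -e; congr (nu _ _).
by rewrite /Af /= tens_map_pure ?rmorph1 //; exact: alghom_lin.
Qed.
End ActBaseChange.

Lemma Wf_id (T : comPzAlgType k) w : Wf (idalg T) w = w.
Proof.
elim/baseExt_ind: w => [|x y hx hy|v s]; first exact: Wf0.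
  by rewrite WfD hx hy.
rewrite Wf_pure; congr epure; elim/tens_ind: s => [|x y hx hy|t p].
- exact: (lin0 (alghom_lin (Rf _))).
- by rewrite (linD (alghom_lin (Rf _))) hx hy.
- by rewrite /Rf /= tens_map_pure.
Qed.
Lemma Wf_comp (T T' T'' : comPzAlgType k) (g : alghom T' T'') (f : alghom T T') w :
  Wf (compalg g f) w = Wf g (Wf f w).
Proof.
elim/baseExt_ind: w => [|x y hx hy|v s]; first by rewrite !Wf0.
  by rewrite !WfD hx hy.
rewrite !Wf_pure; congr epure; elim/tens_ind: s => [|x y hx hy|t p].
- by rewrite !(lin0 (alghom_lin (Rf _))).
- by rewrite !(linD (alghom_lin (Rf _))) hx hy.
- rewrite /Rf /= !tens_map_pure //; try exact: alghom_lin.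
  exact: (alghom_lin (compalg g f)).
Qed.
Lemma Af_id (T : comPzAlgType k) a : Af (idalg T) a = a.
Proof.
elim/tens_ind: a => [|x y hx hy|t p]; first exact: (lin0 (alghom_lin (Af _))).
- by rewrite (linD (alghom_lin (Af _))) hx hy.
- by rewrite /Af /= tens_map_pure.
Qed.
Lemma Af_comp (T T' T'' : comPzAlgType k) (g : alghom T' T'') (f : alghom T T') a :
  Af (compalg g f) a = Af g (Af f a).
Proof.
elim/tens_ind: a => [|x y hx hy|t p]; first by rewrite !(lin0 (alghom_lin (Af _))).
- by rewrite !(linD (alghom_lin (Af _))) hx hy.
- rewrite /Af /= !tens_map_pure //; try exact: alghom_lin.
  exact: (alghom_lin (compalg g f)).
Qed.

Definition rep_map (T T' : comPzAlgType k) (f : alghom T T') (x : rep T) : rep T' :=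
  exist _ (bc_action f (sval x)) (bc_actionP f (svalP x)).

Fact rep_map_id (T : comPzAlgType k) (x : rep T) : rep_map (idalg T) x = x.
Proof.
apply: rep_eq => a w /=; symmetry; move: a w.
by apply: bc_action_unique => [||a w]; [exact: svalP.. | rewrite Af_id !Wf_id].
Qed.
Fact rep_map_comp (T T' T'' : comPzAlgType k) (g : alghom T' T'') (f : alghom T T')
  (x : rep T) : rep_map (compalg g f) x = rep_map g (rep_map f x).
Proof.
apply: rep_eq => a w /=; symmetry; move: a w.
apply: bc_action_unique => [||a w]; [exact: svalP | exact: (svalP (rep_map g (rep_map f x))) |].
rewrite Af_comp !Wf_comp bc_action_Wf; last exact: (svalP (rep_map f x)).
by rewrite bc_action_Wf //; exact: svalP.
Qed.
Definition Rep : algFunctor k := AlgFunctor rep_map_id rep_map_comp.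

Fact gaut_oneP (T : comPzAlgType k) : graded_aut (@id (WT T), @id (WT T)).
Proof. by split. Qed.
Definition gaut_one T : gaut T := exist _ _ (gaut_oneP T).

Fact gaut_mulP (T : comPzAlgType k) (x y : gaut T) : graded_aut
  ((sval x).1 \o (sval y).1, (sval y).2 \o (sval x).2).
Proof.
case: x y => [gx [lx dx lx' dx' xK xK']] [gy [ly dy ly' dy' yK yK']].
split=> [r u v|d w hw|r u v|d w hw||] /=.
- by rewrite ly lx.
- exact/dx/dy.
- by rewrite lx' ly'.
- exact/dy'/dx'.
- exact: can_comp.
- exact: can_comp.
Qed.
Definition gaut_mul T (x y : gaut T) : gaut T := exist _ _ (gaut_mulP x y).

Fact gaut_invP (T : comPzAlgType k) (x : gaut T) :
  graded_aut ((sval x).2, (sval x).1).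
Proof. by case: x => [gx [lx dx lx' dx' xK xK']]; split. Qed.
Definition gaut_inv T (x : gaut T) : gaut T := exist _ _ (gaut_invP x).

Fact gaut_mulA T : associative (@gaut_mul T).
Proof. by move=> x y z; exact: gaut_eq. Qed.
Fact gaut_mul1 T : left_id (gaut_one T) (@gaut_mul T).
Proof. by move=> x; exact: gaut_eq. Qed.
Fact gaut_mulV T : left_inverse (gaut_one T) (@gaut_inv T) (@gaut_mul T).
Proof. by move=> x; apply: gaut_eq => w /=; exact: (gautK (svalP x)). Qed.

Fact gaut_mapP (T T' : comPzAlgType k) (f : alghom T T') (x : gaut T) :
  graded_aut (bc f (sval x).1, bc f (sval x).2).
Proof.
case: x => [gx [lx dx lx' dx' xK xK']] /=.
split=> /= [|d w||d w|w|w]; try exact: bc_linear.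
- rewrite -[d in X in _ -> X]add0r; apply: (@bc_graded _ _ f _ 0) => // e v.
  by rewrite add0r; exact: dx.
- rewrite -[d in X in _ -> X]add0r; apply: (@bc_graded _ _ f _ 0) => // e v.
  by rewrite add0r; exact: dx'.
- rewrite -[LHS](bc_comp f lx' lx) -[RHS](bc_id f); congr (bc f _ w).
  exact/funext.
- rewrite -[LHS](bc_comp f lx lx') -[RHS](bc_id f); congr (bc f _ w).
  exact/funext.
Qed.
Definition gaut_map (T T' : comPzAlgType k) (f : alghom T T') (x : gaut T) : gaut T' :=
  exist _ _ (gaut_mapP f x).

Fact gaut_map_id (T : comPzAlgType k) (x : gaut T) : gaut_map (idalg T) x = x.
Proof.
have [lx _ _ _ _ _] := svalP x; apply: gaut_eq => /=.
apply: (linear_Wf_eq (f := idalg T)) => [||w]; [exact: bc_linear | exact: lx |].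
by rewrite bc_Wf // !Wf_id.
Qed.
Fact gaut_map_comp (T T' T'' : comPzAlgType k) (g : alghom T' T'') (f : alghom T T')
  (x : gaut T) : gaut_map (compalg g f) x = gaut_map g (gaut_map f x).
Proof.
have [lx _ _ _ _ _] := svalP x; have lbx := bc_linear f lx; apply: gaut_eq => /=.
apply: (linear_Wf_eq (f := compalg g f)) => [||w]; [exact: bc_linear.. |].
by rewrite bc_Wf // !Wf_comp !bc_Wf.
Qed.
Definition gaut_functor : algFunctor k := AlgFunctor gaut_map_id gaut_map_comp.

Fact gaut_map_mul (T T' : comPzAlgType k) (f : alghom T T') (x y : gaut T) :
  gaut_map f (gaut_mul x y) = gaut_mul (gaut_map f x) (gaut_map f y).
Proof.
have [lx _ _ _ _ _] := svalP x; have [ly _ _ _ _ _] := svalP y.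
by apply: gaut_eq => w /=; exact: bc_comp.
Qed.

(* The functor of points of the algebraic group G_V = Aut_R(V (x) R)_0:
   T-points are the graded R_T-automorphisms of V (x) R_T. *)
Definition GV : groupFunctor k :=
  @GroupFunctor k gaut_functor gaut_one gaut_mul gaut_inv
    gaut_mulA gaut_mul1 gaut_mulV gaut_map_mul.

Fact rep_actP (T : comPzAlgType k) (g : gaut T) (x : rep T) :
  framed_action (fun a w => (sval g).1 (sval x a ((sval g).2 w))).
Proof.
case: g x => [gg [lg dg lg' dg' gK gK']] [mu [m1 mM mDl mDr mE mG]] /=.
split=> [w|a b w|a b w|a w w'|r w|d e a w ha hw].
- by rewrite m1 gK'.
- by rewrite gK mM.
- by rewrite mDl (linD lg).
- by rewrite (linD lg') mDr (linD lg).
- by rewrite mE (linZ lg) gK'.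
- by apply: dg; apply: mG => //; apply: dg'.
Qed.

(* Change of framing: g replaces the framing phi : V (x) R_T -> M by
   phi \o g^-1. *)
Definition rep_act (T : comPzAlgType k) (g : GV T) (x : Rep T) : Rep T :=
  exist _ _ (rep_actP g x).

(* A graded A_T-module with an isomorphism of graded R_T-modules from
   V (x) R_T; the latter transports the direct sum decomposition. *)
Record framed_family (T : comPzAlgType k) := FramedFamily {
  fam_mod : lmodType (AT T);
  fam_deg : int -> fam_mod -> Prop;
  fam_graded : forall d e a m,
    degAT d a -> fam_deg e m -> fam_deg (d + e) (a *: m);
  frame : WT T -> fam_mod;
  frame_bij : bijective frame;
  frameD : {morph frame : w w' / w + w'};
  frameZ : forall r w, frame (r *: w) = iotaT T r *: frame w;
  frame_deg : forall d w, degWT d w <-> fam_deg d (frame w)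
}.

Definition framed_iso (T : comPzAlgType k) (M N : framed_family T) :=
  exists u : fam_mod M -> fam_mod N, [/\ linear u, bijective u,
    forall d m, fam_deg d m <-> fam_deg d (u m) & u \o frame M =1 frame N].

Definition family_structure (T : comPzAlgType k) (M : framed_family T) (x : rep T) :=
  forall a w, frame M (sval x a w) = a *: frame M w.

(* [rep T] is in bijection with the isomorphism classes of framed families. *)
Lemma family_structure_exists (T : comPzAlgType k) (M : framed_family T) :
  exists! x : rep T, family_structure M x.
Proof.
have [h hK Kh] := frame_bij M; pose mu a w := h (a *: frame M w).
have hmu : framed_action mu.
  split=> [w|a b w|a b w|a w w'|r w|d e a w ha hw]; rewrite /mu.
  - by rewrite scale1r hK.
  - by rewrite Kh scalerA.
  - by apply: (can_inj hK); rewrite frameD !Kh scalerDl.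
  - by apply: (can_inj hK); rewrite !frameD !Kh scalerDr.
  - by rewrite -frameZ hK.
  - by apply/(frame_deg M); rewrite Kh; apply: fam_graded => //; apply/(frame_deg M).
exists (exist _ mu hmu); split=> [a w|y hy]; first by rewrite /= /mu Kh.
by apply: rep_eq => a w; apply: (can_inj hK); rewrite hy /= /mu Kh.
Qed.

Lemma family_structure_iso (T : comPzAlgType k) (M N : framed_family T) (x y : rep T) :
  family_structure M x -> family_structure N y -> framed_iso M N <-> x = y.
Proof.
move=> hx hy; have [h hK Kh] := frame_bij M; have [h' hK' Kh'] := frame_bij N.
split=> [[u [lu bu du uE]]|exy].
  apply: rep_eq => a w; apply: (can_inj hK'); rewrite hy -!uE /= hx.
  exact: linZ lu a _.
exists (frame N \o h); split.
- move=> a m m' /=; rewrite -(Kh m) -(Kh m') -hx -frameD !hK frameD; congr (_ + _).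
  by rewrite exy hy.
- by apply: bij_comp; [exists h' | exists (frame M)].
- by move=> d m; rewrite -{1}(Kh m) /= -!frame_deg.
- by move=> w /=; rewrite hK.
Qed.

Section Tautological.
Variables (T : comPzAlgType k) (x : rep T).
Definition taut_mod : Type := let _ := x in WT T.
HB.instance Definition _ := GRing.Zmodule.copy taut_mod (WT T).
Let scale (a : AT T) (w : taut_mod) : taut_mod := sval x a w.
Fact taut_scaleA a b w : scale a (scale b w) = scale (a * b) w.
Proof. by rewrite /scale (factM (svalP x)). Qed.
Fact taut_scale1 : left_id 1 scale.
Proof. exact: (fact1 (svalP x)). Qed.
Fact taut_scaleDr : right_distributive scale +%R.
Proof. exact: (factDr (svalP x)). Qed.
Fact taut_scaleDl w : {morph scale^~ w : a b / a + b}.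
Proof. by move=> a b; exact: (factDl (svalP x)). Qed.
HB.instance Definition _ := GRing.Zmodule_isLmodule.Build (AT T) taut_mod
  taut_scaleA taut_scale1 taut_scaleDr taut_scaleDl.
End Tautological.

Lemma family_structure_onto (T : comPzAlgType k) (x : rep T) :
  exists M : framed_family T, family_structure M x.
Proof.
have hx := svalP x.
unshelve eexists (@FramedFamily T (taut_mod x) (@degWT T) _ id _ _ _ _) => //=.
- exact: (fact_graded hx).
- by exists id.
- by move=> r w; rewrite -(fact_extends hx).
Qed.

End Framed.
Arguments rep_act {k A degA n iota V degV grA iotaC} T g x.

(* Main.v *)
Require Import Defs.
From HB Require Import structures.
From mathcomp Require Import all_boot all_order all_algebra.
From mathcomp Require Import boolp ssrcomplements mpoly.

(** Over a test algebra T, a module structure on V (x) R_T is determined by the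
    R_T-linear operators through which finitely many homogeneous generators of A
    over R act, and a point of G_V by an automorphism and its inverse. All these
    operators have prescribed degrees. The variables of R have positive degree,
    because A is non-negatively graded with finite dimensional degree-0 part
    ([monomial_weights]); hence an operator of prescribed degree has matrix entries
    in a finite dimensional part of R, and a point over T is given by finitely many
    coordinates in T ([degree_bound], [op_frame1]).

    Instead of writing out the equations between these coordinates, take for B the
    polynomial ring on them modulo all polynomials that vanish at every point over
    every test algebra. This B is finitely generated, and it embeds into the product
    of the test algebras over all points ([coord_pt_separates]). Consequently an
    equality in V (x) R_B, or membership in one of its graded pieces, holds as soon as
    it holds after specialisation at every point ([points_separate],
    [points_degWT]). So a universal structure over B satisfies its axioms because
    every single structure does, and it only remains to see that products exist
    over B; this reduces to generators, whose matrices have the coordinate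
    variables as entries ([universal_operators], [gen_op_universal],
    [aut_op_universal]). A universal point with tautological coordinates represents
    the functor ([operator_functor_representable]).

    The action is algebraic by Yoneda: its comorphism is the result of acting with the
    universal group element on the universal module structure, both base changed to
    H (x) B ([group_action_algebraic]). *)

Set Implicit Arguments.
Unset Strict Implicit.
Unset Printing Implicit Defensive.

Import Order.TTheory GRing.Theory Num.Theory.
Local Open Scope ring_scope.

(** * Evaluation of polynomials in a possibly zero algebra *)

Section Evaluation.
Context (k : comNzRingType) (n : nat).

Lemma mpoly_linear_eq (U : lmodType k) (f g : {mpoly k[n]} -> U) :
  linear f -> linear g -> (forall m, f 'X_[m] = g 'X_[m]) -> f =1 g.
Proof.
move=> lf lg fg p; elim/mpolyind: p => [|c m p _ _ IH].
  by rewrite (lin0 lf) (lin0 lg).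
by rewrite lf lg fg IH.
Qed.

Lemma alghom_mpoly_eq (T : comPzAlgType k) (f g : alghom {mpoly k[n]} T) :
  (forall i, f 'X_i = g 'X_i) -> f = g.
Proof.
move=> fg; apply/alghom_eq/mpoly_linear_eq => [||m]; try exact: alghom_lin.
rewrite mpolyXE_id !rmorph_prod; apply: eq_bigr => i _.
by rewrite !rmorphXn /= fg.
Qed.

Variables (T : comPzAlgType k) (y : 'I_n -> T).

(** Evaluation is defined by its formula because T may be the zero ring. *)
Definition mon_eval (m : 'X_{1..n}) : T := \prod_(i < n) y i ^+ m i.
Definition poly_eval (p : {mpoly k[n]}) : T :=
  \sum_(m <- msupp p) p@_m *: mon_eval m.

Lemma poly_evalE p b : (msize p <= b)%N ->
  poly_eval p = \sum_(m : 'X_{1..n < b}) p@_m *: mon_eval m.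
Proof.
move=> pb; rewrite /poly_eval (big_mksub 'X_{1..n < b}) ?msupp_uniq //=; first last.
  by move=> m /msize_mdeg_lt /leq_trans; apply.
by rewrite big_rmcond //= => m /memN_msupp_eq0 ->; rewrite scale0r.
Qed.

Fact poly_eval_linear : linear poly_eval.
Proof.
move=> c p q; pose b := maxn (msize (c *: p + q)) (maxn (msize p) (msize q)).
rewrite !(@poly_evalE _ b); try by rewrite /b !leq_max leqnn ?orbT.
rewrite scaler_sumr -big_split; apply: eq_bigr => m _ /=.
by rewrite mcoeffD mcoeffZ scalerDl scalerA.
Qed.

Lemma poly_evalX m : poly_eval 'X_[m] = mon_eval m.
Proof. by rewrite /poly_eval msuppX big_seq1 mcoeffX eqxx scale1r. Qed.

Fact poly_eval_monoid : monoid_morphism poly_eval.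
Proof.
split=> [|p q].
  rewrite -(mpolyX0 n k) poly_evalX /mon_eval big1 // => i _.
  by rewrite mnm0E expr0.
have l := poly_eval_linear.
move: p; apply: mpoly_linear_eq => [c u v|c u v|m].
- by rewrite mulrDl -pzscalerAl l.
- by rewrite l mulrDl -pzscalerAl.
move: q; apply: mpoly_linear_eq => [c u v|c u v|m'].
- by rewrite mulrDr -pzscalerAr l.
- by rewrite l mulrDr -pzscalerAr.
rewrite -mpolyXD !poly_evalX /mon_eval -big_split; apply: eq_bigr => i _ /=.
by rewrite mnmDE exprD.
Qed.

Definition evalalg : alghom {mpoly k[n]} T :=
  AlgHom poly_eval_linear poly_eval_monoid.

Lemma evalalgX i : evalalg 'X_i = y i.
Proof.
rewrite /= poly_evalX /mon_eval (bigD1 i) //= mnm1E eqxx expr1 big1 ?mulr1 //.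
by move=> j ji; rewrite mnm1E eq_sym (negPf ji) expr0.
Qed.
End Evaluation.

(** * Quotients by possibly improper ideals *)

(** Ideals need not be proper: the functor of points of an empty scheme is
    represented by the zero algebra. *)
Record ideal (k : comNzRingType) (P : comPzAlgType k) := Ideal {
  ideal_mem :> P -> Prop;
  ideal0 : ideal_mem 0;
  idealD : forall x y, ideal_mem x -> ideal_mem y -> ideal_mem (x + y);
  idealM : forall x y, ideal_mem y -> ideal_mem (x * y)
}.

Section Quotient.
Local Open Scope quotient_scope.
Context (k : comNzRingType) (P : comPzAlgType k) (I : ideal P).

Definition quot_rel (x y : P) := `[< I (x - y) >].
Fact quot_rel_equiv : equiv_class_of quot_rel.
Proof.
have IN x : I x -> I (- x) by move=> Ix; rewrite -mulN1r; exact: idealM.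
split.
- by move=> x; apply/asboolP; rewrite subrr; exact: ideal0.
- by move=> x y; apply/asboolP/asboolP => /IN; rewrite opprB.
- move=> y x z /asboolP h1 /asboolP h2; apply/asboolP.
  by rewrite -[x](subrK y) -addrA; exact: idealD.
Qed.
Canonical quot_equiv := EquivRelPack quot_rel_equiv.
Definition quotalg : Type := {eq_quot quot_equiv}.
HB.instance Definition _ := Choice.on quotalg.
HB.instance Definition _ := Quotient.on quotalg.

Definition quot_pi (x : P) : quotalg := \pi_quotalg x.

Lemma quot_piP x y : quot_pi x = quot_pi y <-> I (x - y).
Proof. by split=> [/eqmodP/asboolP|h]; last exact/eqmodP/asboolP. Qed.
Lemma quot_piK (x : quotalg) : quot_pi (repr x) = x.
Proof. exact: reprK. Qed.
Lemma quot_ind (K : quotalg -> Prop) : (forall x, K (quot_pi x)) -> forall x, K x.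
Proof. by move=> h x; rewrite -[x]quot_piK. Qed.

Definition quot_add (x y : quotalg) := quot_pi (repr x + repr y).
Definition quot_mul (x y : quotalg) := quot_pi (repr x * repr y).
Definition quot_scale (c : k) (x : quotalg) := quot_pi (c *: repr x).
Definition quot_opp (x : quotalg) := quot_pi (- repr x).

Lemma quot_repr x : I (repr (quot_pi x) - x).
Proof. by apply/quot_piP; rewrite quot_piK. Qed.
Lemma quot_piD x y : quot_add (quot_pi x) (quot_pi y) = quot_pi (x + y).
Proof. by apply/quot_piP; rewrite opprD addrACA; apply: idealD; exact: quot_repr. Qed.
Lemma quot_piM x y : quot_mul (quot_pi x) (quot_pi y) = quot_pi (x * y).
Proof.
apply/quot_piP.
have -> : repr (quot_pi x) * repr (quot_pi y) - x * y =
    repr (quot_pi x) * (repr (quot_pi y) - y) + y * (repr (quot_pi x) - x).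
  by rewrite !mulrBr [y * repr _]mulrC [y * x]mulrC addrA subrK.
by apply: idealD; apply: idealM; exact: quot_repr.
Qed.
Lemma quot_piZ c x : quot_scale c (quot_pi x) = quot_pi (c *: x).
Proof.
apply/quot_piP; rewrite -scalerBr -[_ - _]mul1r pzscalerAl.
by apply: idealM; exact: quot_repr.
Qed.
Lemma quot_piN x : quot_opp (quot_pi x) = quot_pi (- x).
Proof.
apply/quot_piP; rewrite -opprD -mulN1r; apply: idealM; exact: quot_repr.
Qed.

Fact quot_addA : associative quot_add.
Proof. by do 3!elim/quot_ind => ?; rewrite !quot_piD addrA. Qed.
Fact quot_addC : commutative quot_add.
Proof. by do 2!elim/quot_ind => ?; rewrite !quot_piD addrC. Qed.
Fact quot_add0 : left_id (quot_pi 0) quot_add.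
Proof. by elim/quot_ind => ?; rewrite !quot_piD add0r. Qed.
Fact quot_addN : left_inverse (quot_pi 0) quot_opp quot_add.
Proof. by elim/quot_ind => ?; rewrite quot_piN quot_piD addNr. Qed.
HB.instance Definition _ :=
  GRing.isZmodule.Build quotalg quot_addA quot_addC quot_add0 quot_addN.

Fact quot_mulA : associative quot_mul.
Proof. by do 3!elim/quot_ind => ?; rewrite !quot_piM mulrA. Qed.
Fact quot_mulC : commutative quot_mul.
Proof. by do 2!elim/quot_ind => ?; rewrite !quot_piM mulrC. Qed.
Fact quot_mul1 : left_id (quot_pi 1) quot_mul.
Proof. by elim/quot_ind => ?; rewrite !quot_piM mul1r. Qed.
Fact quot_mulDl : left_distributive quot_mul +%R.
Proof.
do 3!elim/quot_ind => ?.
by rewrite -[X in quot_mul X]/(quot_add _ _) -[RHS]/(quot_add _ _) !(quot_piD, quot_piM) mulrDl.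
Qed.
HB.instance Definition _ := GRing.Zmodule_isComPzRing.Build quotalg
  quot_mulA quot_mulC quot_mul1 quot_mulDl.

Fact quot_scaleA a b (x : quotalg) : quot_scale a (quot_scale b x) = quot_scale (a * b) x.
Proof. by elim/quot_ind: x => x; rewrite !quot_piZ scalerA. Qed.
Fact quot_scale1 : left_id 1 quot_scale.
Proof. by elim/quot_ind => x; rewrite quot_piZ scale1r. Qed.
Fact quot_scaleDr : right_distributive quot_scale +%R.
Proof.
move=> c; do 2!elim/quot_ind => ?.
rewrite -[X in quot_scale _ X]/(quot_add _ _) -[RHS]/(quot_add _ _).
by rewrite !(quot_piD, quot_piZ) scalerDr.
Qed.
Fact quot_scaleDl (x : quotalg) : {morph quot_scale^~ x : a b / a + b}.
Proof.
move=> a b; elim/quot_ind: x => x.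
by rewrite -[RHS]/(quot_add _ _) !(quot_piD, quot_piZ) scalerDl.
Qed.
HB.instance Definition _ := GRing.Zmodule_isLmodule.Build k quotalg
  quot_scaleA quot_scale1 quot_scaleDr quot_scaleDl.

Fact quot_scaleAl (c : k) (x y : quotalg) : c *: (x * y) = (c *: x) * y.
Proof.
elim/quot_ind: x => x; elim/quot_ind: y => y.
rewrite -[LHS]/(quot_scale c (quot_mul _ _)) -[RHS]/(quot_mul (quot_scale c _) _).
by rewrite !(quot_piM, quot_piZ) pzscalerAl.
Qed.
Fact quot_scaleAr (c : k) (x y : quotalg) : c *: (x * y) = x * (c *: y).
Proof. by rewrite mulrC quot_scaleAl mulrC. Qed.
HB.instance Definition _ := isPzAlgebra.Build k quotalg quot_scaleAl quot_scaleAr.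

Fact quot_pi_linear : linear quot_pi.
Proof. by move=> c x y; rewrite -quot_piD -quot_piZ. Qed.
Fact quot_pi_monoid : monoid_morphism quot_pi.
Proof. by split=> // x y; rewrite -quot_piM. Qed.
Definition quot_proj : alghom P quotalg := AlgHom quot_pi_linear quot_pi_monoid.

Section Factor.
Variables (T : comPzAlgType k) (f : alghom P T).
Hypothesis fI : forall x, I x -> f x = 0.
Definition quot_lift_fun (x : quotalg) : T := f (repr x).
Lemma quot_lift_pi x : quot_lift_fun (quot_pi x) = f x.
Proof. by apply/eqP; rewrite -subr_eq0 -raddfB; apply/eqP/fI; exact: quot_repr. Qed.
Fact quot_lift_linear : linear quot_lift_fun.
Proof.
move=> c; do 2!elim/quot_ind => ?.
by rewrite -quot_pi_linear !quot_lift_pi linearP.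
Qed.
Fact quot_lift_monoid : monoid_morphism quot_lift_fun.
Proof.
split; first by rewrite -[1]/(quot_pi 1) quot_lift_pi rmorph1.
do 2!elim/quot_ind => ?.
by rewrite -quot_pi_monoid.2 !quot_lift_pi rmorphM.
Qed.
Definition quot_lift : alghom quotalg T := AlgHom quot_lift_linear quot_lift_monoid.
End Factor.
End Quotient.
Arguments quot_pi {k P} I x.

(** * Functors with finitely many natural coordinates *)

Section Coordinates.
Context (k : comNzRingType) (F : algFunctor k) (J : finType).
Variable c : forall T : comPzAlgType k, F T -> J -> T.
Hypothesis c_nat : forall (T T' : comPzAlgType k) (f : alghom T T') x j,
  c (fmap f x) j = f (c x j).

Definition coord_eval (T : comPzAlgType k) (x : F T) : alghom {mpoly k[#|J|]} T :=
  evalalg (fun i => c x (enum_val i)).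

(** The relations imposed on the coordinates: all those satisfied at every point
    over every test algebra, in place of an explicit list of equations. *)
Definition vanishing (p : {mpoly k[#|J|]}) :=
  forall (T : comPzAlgType k) (x : F T), coord_eval x p = 0.
Fact vanishing0 : vanishing 0.
Proof. by move=> T x; rewrite raddf0. Qed.
Fact vanishingD p q : vanishing p -> vanishing q -> vanishing (p + q).
Proof. by move=> hp hq T x; rewrite raddfD /= [X in X + _]hp [X in _ + X]hq addr0. Qed.
Fact vanishingM p q : vanishing q -> vanishing (p * q).
Proof. by move=> hq T x; rewrite rmorphM /= [X in _ * X]hq mulr0. Qed.
Definition vanishing_ideal := Ideal vanishing0 vanishingD vanishingM.

Definition coord_alg : comPzAlgType k := quotalg vanishing_ideal.
Definition coord_var (j : J) : coord_alg := quot_pi vanishing_ideal 'X_(enum_rank j).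

Lemma coord_alg_fin_gen : fin_gen_alg coord_alg.
Proof.
exists #|J|, (quot_proj vanishing_ideal) => b; split=> // _.
by exists (repr b); exact: quot_piK.
Qed.

Fact coord_eval_vanishing (T : comPzAlgType k) (x : F T) p :
  vanishing_ideal p -> coord_eval x p = 0.
Proof. by move=> h; exact: h. Qed.
Definition coord_pt (T : comPzAlgType k) (x : F T) : alghom coord_alg T :=
  quot_lift (coord_eval_vanishing x).

Lemma coord_pt_pi (T : comPzAlgType k) (x : F T) p :
  coord_pt x (quot_pi vanishing_ideal p) = coord_eval x p.
Proof. exact: (quot_lift_pi (coord_eval_vanishing x)). Qed.

Lemma coord_pt_var (T : comPzAlgType k) (x : F T) j : coord_pt x (coord_var j) = c x j.
Proof. by rewrite coord_pt_pi [LHS]evalalgX enum_rankK. Qed.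

Lemma coord_alghom_eq (T : comPzAlgType k) (f g : alghom coord_alg T) :
  (forall j, f (coord_var j) = g (coord_var j)) -> f = g.
Proof.
move=> e; apply: alghom_eq; elim/quot_ind => p.
have e' : compalg f (quot_proj vanishing_ideal) = compalg g (quot_proj vanishing_ideal).
  by apply: alghom_mpoly_eq => i /=; have := e (enum_val i); rewrite /coord_var enum_valK.
exact: (congr1 (fun h : alghom _ _ => h p) e').
Qed.

Lemma coord_pt_nat (T T' : comPzAlgType k) (f : alghom T T') (x : F T) :
  coord_pt (fmap f x) = compalg f (coord_pt x).
Proof.
apply: coord_alghom_eq => j; rewrite coord_pt_var c_nat.
by rewrite -[RHS]/(f (coord_pt x (coord_var j))) coord_pt_var.
Qed.

(** The reason for dividing by the ideal of all vanishing polynomials: [coord_alg]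
    embeds into the product of the test algebras over all points, so that an
    identity over it can be checked pointwise. *)
Lemma coord_pt_separates (b b' : coord_alg) :
  (forall (T : comPzAlgType k) (x : F T), coord_pt x b = coord_pt x b') -> b = b'.
Proof.
elim/quot_ind: b => p; elim/quot_ind: b' => q h; apply/quot_piP => T x.
by rewrite raddfB -[X in X - _]coord_pt_pi -[X in _ - X]coord_pt_pi h subrr.
Qed.

(** A point with the tautological coordinates is universal: its image under an
    algebra map has as coordinates the images of the variables. *)
Lemma coord_represents (u : F coord_alg) :
  (forall T, injective (@c T)) -> (forall j, c u j = coord_var j) ->
  represents coord_pt.
Proof.
move=> c_inj cu; split; last exact: coord_pt_nat.
move=> T; exists (fun f => fmap f u) => [x|f].
  by apply/c_inj/funext => j; rewrite c_nat cu coord_pt_var.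
by apply: coord_alghom_eq => j; rewrite coord_pt_var c_nat cu.
Qed.
End Coordinates.

(** * Actions of representable groups are algebraic *)

Section Yoneda.
Context (k : comNzRingType).

Section Coproduct.
Context (H B T : comPzAlgType k).

Fact tens_inl_linear : linear (fun h : H => pure h (1 : B)).
Proof. exact: (pure_bilin H B).2. Qed.
Fact tens_inl_monoid : monoid_morphism (fun h : H => pure h (1 : B)).
Proof. by split=> // x y; rewrite pureM mulr1. Qed.
Definition tens_inl : alghom H (tens H B) := AlgHom tens_inl_linear tens_inl_monoid.
Fact tens_inr_linear : linear (fun b : B => pure (1 : H) b).
Proof. exact: (pure_bilin H B).1. Qed.
Fact tens_inr_monoid : monoid_morphism (fun b : B => pure (1 : H) b).
Proof. by split=> // x y; rewrite pureM mulr1. Qed.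
Definition tens_inr : alghom B (tens H B) := AlgHom tens_inr_linear tens_inr_monoid.

Variables (f : alghom H T) (g : alghom B T).
Fact copair_bilin : bilin (fun (h : H) (b : B) => f h * g b).
Proof.
split=> [h|b] c x y /=; rewrite linearP /=.
- by rewrite mulrDr -pzscalerAr.
- by rewrite mulrDl -pzscalerAl.
Qed.
Definition copair_fun := tens_lift (fun (h : H) (b : B) => f h * g b).
Fact copair_linear : linear copair_fun.
Proof. exact: tens_lift_linear copair_bilin. Qed.
Lemma copair_pure h b : copair_fun (pure h b) = f h * g b.
Proof. exact: tens_lift_pure copair_bilin h b. Qed.
Fact copair_monoid : monoid_morphism copair_fun.
Proof.
have l := copair_linear; split=> [|x y].
  by rewrite [LHS]copair_pure !rmorph1 mulr1.
elim/tens_ind: x => [|x x' hx hx'|a b]; first by rewrite mul0r (lin0 l) mul0r.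
  by rewrite mulrDl !(linD l) hx hx' mulrDl.
elim/tens_ind: y => [|y y' hy hy'|a' b']; first by rewrite mulr0 (lin0 l) mulr0.
  by rewrite mulrDr !(linD l) hy hy' mulrDr.
by rewrite pureM !copair_pure !rmorphM mulrACA.
Qed.
Definition copair : alghom (tens H B) T := AlgHom copair_linear copair_monoid.

Lemma copair_inl : compalg copair tens_inl = f.
Proof. by apply: alghom_eq => h /=; rewrite copair_pure rmorph1 mulr1. Qed.
Lemma copair_inr : compalg copair tens_inr = g.
Proof. by apply: alghom_eq => b /=; rewrite copair_pure rmorph1 mul1r. Qed.
End Coproduct.

Lemma represents_universal (F : algFunctor k) (B : comPzAlgType k)
    (Phi : forall T : comPzAlgType k, F T -> alghom B T) :
  represents Phi -> exists u : F B, forall T (x : F T), fmap (Phi T x) u = x.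
Proof.
move=> [bij nat]; have [h hK Kh] := bij B; exists (h (idalg B)) => T x.
apply: (bij_inj (bij T)); rewrite nat Kh; exact: alghom_eq.
Qed.

(** By Yoneda: the comorphism is the point of F over H (x) B obtained by letting the
    universal group element act on the universal point; every other instance of the
    action is a specialisation of this one. *)
Lemma group_action_algebraic (G : groupFunctor k) (F : algFunctor k)
    (act : forall T, G T -> F T -> F T) (H B : comPzAlgType k)
    (Psi : forall T : comPzAlgType k, G T -> alghom H T)
    (Phi : forall T : comPzAlgType k, F T -> alghom B T) :
  represents Psi -> represents Phi -> group_action act ->
  algebraic_action Psi Phi act.
Proof.
move=> rG rF hact; have [g0 g0E] := represents_universal rG.
have [x0 x0E] := represents_universal rF.
pose g1 : G (tens H B) := fmap (tens_inl H B) g0.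
pose x1 : F (tens H B) := fmap (tens_inr H B) x0.
exists (Phi _ (act _ g1 x1)) => T g x b; pose f := copair (Psi T g) (Phi T x).
have eg : fmap f g1 = g by rewrite -fmap_comp copair_inl g0E.
have ex : fmap f x1 = x by rewrite -fmap_comp copair_inr x0E.
by rewrite -{1}eg -{1}ex -(gact_nat hact) rF.2.
Qed.
End Yoneda.

(** * Homogeneous components, generators and frames *)

Section Components.
Context (U : zmodType) (G : int -> U -> Prop) (grU : grading G).

Lemma gradingN d x : G d x -> G d (- x).
Proof. by move=> h; rewrite -sub0r; apply: gradingB => //; exact: grading0. Qed.
Lemma gradingD d x y : G d x -> G d y -> G d (x + y).
Proof. by move=> hx hy; rewrite -[y]opprK; apply: gradingB => //; exact: gradingN. Qed.
Lemma big_widen_support (s t : seq int) (c : int -> U) :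
  uniq s -> uniq t -> {subset s <= t} -> (forall d, d \notin s -> c d = 0) ->
  \sum_(d <- s) c d = \sum_(d <- t) c d.
Proof.
move=> us ut st z; rewrite [RHS](bigID (mem s)) /= [X in _ = _ + X]big1 ?addr0; last first.
  by move=> d /z.
rewrite -[RHS]big_filter; apply/perm_big/uniq_perm; rewrite ?filter_uniq //.
by move=> d; rewrite mem_filter /=; case: (boolP (d \in s)) => // /st ->.
Qed.

(** A decomposition is a function on all degrees rather than a list of summands, so
    that it is unique as an object. *)
Definition decomposes (x : U) (c : int -> U) := (forall d, G d (c d)) /\
  exists s, [/\ uniq s, forall d, d \notin s -> c d = 0 & x = \sum_(d <- s) c d].

Lemma decomposition_exists x : exists c, decomposes x c.
Proof.
have [s [c [hc ->]]] := grading_span grU x.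
elim: s => [|d s [c' [hc' [s' [us' z' e']]]]].
  exists (fun=> 0); split=> [d|]; first exact: grading0.
  by exists [::]; rewrite !big_nil; split.
pose t := undup (d :: s').
exists (fun e => c' e + (if e == d then c e else 0)); split=> [e|].
  by apply: gradingD => //; case: eqP => // _; exact: grading0.
exists t; split; first exact: undup_uniq.
  move=> e; rewrite mem_undup inE negb_or => /andP[ed es].
  by rewrite (negPf ed) z' // addr0.
have ut : uniq t := undup_uniq _.
have st : {subset s' <= t} by move=> e es; rewrite mem_undup inE es orbT.
have dt : {subset [:: d] <= t} by move=> e; rewrite inE mem_undup => /eqP ->; rewrite mem_head.
rewrite big_cons e' big_split /= addrC -(big_widen_support us' ut st z').
rewrite -(big_widen_support _ ut dt) ?big_seq1 ?eqxx // => e.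
by rewrite inE => /negPf ->.
Qed.

Lemma decomposition_unique x c c' : decomposes x c -> decomposes x c' -> c = c'.
Proof.
move=> [hc [s [us zs es]]] [hc' [s' [us' zs' es']]].
pose t := undup (s ++ s'); have ut : uniq t := undup_uniq _.
have st : {subset s <= t} by move=> d ds; rewrite mem_undup mem_cat ds.
have st' : {subset s' <= t} by move=> d ds; rewrite mem_undup mem_cat ds orbT.
apply/funext => d; apply/eqP; rewrite -subr_eq0; apply/eqP.
have [dt|dt] := boolP (d \in t); last first.
  rewrite zs ?zs' ?subrr //; first by apply: contra dt; exact: st'.
  by apply: contra dt; exact: st.
apply: (grading_free grU ut (c := fun d => c d - c' d)) => // [e|].
  exact: gradingB.
rewrite sumrB -(big_widen_support us ut st zs) -(big_widen_support us' ut st' zs').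
by rewrite -es -es' subrr.
Qed.

Definition component (d : int) (x : U) : U := sval (cid (decomposition_exists x)) d.

Lemma componentP x : decomposes x (component^~ x).
Proof. exact: svalP (cid (decomposition_exists x)). Qed.
Lemma component_homog d x : G d (component d x).
Proof. exact: (componentP x).1. Qed.
Lemma component_unique x c d : decomposes x c -> component d x = c d.
Proof. by move=> h; rewrite -(decomposition_unique (componentP x) h). Qed.

Lemma component_id e x d : G e x -> component d x = if d == e then x else 0.
Proof.
move=> hx; apply: (component_unique (c := fun d => if d == e then x else 0)).
split=> [i|]; first by case: eqP => [->|_] //; exact: grading0.
exists [:: e]; rewrite big_seq1 eqxx; split=> // i.
by rewrite inE => /negPf ->.
Qed.

Lemma componentD d x y : component d (x + y) = component d x + component d y.
Proof.
apply: (component_unique (c := fun d => component d x + component d y)).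
have [hx [s [us zs es]]] := componentP x; have [hy [s' [us' zs' es']]] := componentP y.
pose t := undup (s ++ s'); have ut : uniq t := undup_uniq _.
have st : {subset s <= t} by move=> i ds; rewrite mem_undup mem_cat ds.
have st' : {subset s' <= t} by move=> i ds; rewrite mem_undup mem_cat ds orbT.
split=> [i|]; first exact: gradingD.
exists t; split=> // [i it|].
  rewrite zs ?zs' ?addr0 //; first by apply: contra it; exact: st'.
  by apply: contra it; exact: st.
rewrite big_split -(big_widen_support us ut st zs) -(big_widen_support us' ut st' zs').
by rewrite -es -es'.
Qed.

Lemma component0 d : component d 0 = 0.
Proof. by apply: (addIr (component d 0)); rewrite -componentD !add0r. Qed.

Lemma component_sum d (I : Type) (r : seq I) (P : pred I) (f : I -> U) :
  component d (\sum_(i <- r | P i) f i) = \sum_(i <- r | P i) component d (f i).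
Proof. by apply: (big_morph (component d)); [exact: componentD | exact: component0]. Qed.

Lemma component_span x : exists s : seq int, forall t : seq int,
  uniq t -> {subset s <= t} -> x = \sum_(d <- t) component d x.
Proof.
have [_ [s [us zs es]]] := componentP x; exists s => t ut st.
by rewrite -(big_widen_support us ut st zs).
Qed.
End Components.

Lemma component_linear (k : pzRingType) (U : lmodType k) (G : int -> U -> Prop)
    (grU : grading G) d :
  (forall e c x, G e x -> G e (c *: x)) -> linear (component grU d).
Proof.
move=> GZ c x y; rewrite componentD; congr (_ + _).
have [hx [s [us zs es]]] := componentP grU x.
apply: (component_unique grU (c := fun d => c *: component grU d x)); split=> [e|].
  exact/GZ.
exists s; split=> // [e /zs ->|]; first by rewrite scaler0.
by rewrite -scaler_sumr -es.
Qed.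

Lemma homogeneous_generators (A : pzRingType) (G : int -> A -> Prop) (S : A -> Prop) :
  grading G -> module_finite S ->
  exists (J : finType) (a : J -> A) (da : J -> int), (forall j, G (da j) (a j)) /\
    forall x, exists c : J -> A, (forall j, S (c j)) /\ x = \sum_j c j * a j.
Proof.
move=> grA [m [e he]].
have /choice[s hs] : forall i, exists s : seq int,
    e i = \sum_(d <- s) component grA d (e i).
  move=> i; have [s hs] := component_span grA (e i); exists (undup s).
  by apply: hs; [exact: undup_uniq | move=> d; rewrite mem_undup].
(* the components of the given generators, indexed by generator and degree *)
exists {i : 'I_m & 'I_(size (s i))}.
exists (fun j => component grA (tnth (in_tuple (s (tag j))) (tagged j)) (e (tag j))).
exists (fun j => tnth (in_tuple (s (tag j))) (tagged j)).
split=> [j|x]; first exact: component_homog.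
have [c [Sc ->]] := he x; exists (fun j => c (tag j)); split=> // .
under eq_bigr => i _ do rewrite {1}(hs i) mulr_sumr.
under eq_bigr => i _ do rewrite big_tnth.
by rewrite sig_big_dep.
Qed.

(** The vectors [e p] span V and [phi] provides coefficients, but they need not be
    independent: the components of the members of any basis will do. What matters is
    that each coefficient only sees the part of V of its own degree. *)
Lemma homogeneous_frame (k : fieldType) (V : vectType k) (degV : int -> {vspace V}) :
  grading (fun d (v : V) => v \in degV d) ->
  exists (P : finType) (e : P -> V) (phi : P -> V -> k) (dv : P -> int),
    [/\ forall p, linear (phi p : V -> k^o),
        forall v, v = \sum_p phi p v *: e p,
        forall p, e p \in degV (dv p)
      & forall d p v, v \in degV d -> d != dv p -> phi p v = 0].
Proof.
move=> grV; pose b := vbasis {:V}.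
have lc d : linear (component grV d).
  by apply: component_linear => i c v; exact: memvZ.
have /choice[s hs] := component_span grV.
(* all degrees occurring in the basis b, hence all degrees occurring in V *)
pose S := undup (flatten [seq s b`_i | i : 'I_(\dim {:V})]).
have hS v : v = \sum_(d <- S) component grV d v.
  rewrite [v in LHS](coord_vbasis (memvf v)) [in RHS](coord_vbasis (memvf v)) -/b.
  under [RHS]eq_bigr => d _ do rewrite component_sum.
  rewrite exchange_big /=; apply: eq_bigr => i _.
  under eq_bigr => d _ do rewrite (linZ (lc d)).
  rewrite -scaler_sumr -hs ?undup_uniq // => d ds; rewrite mem_undup.
  by apply/flattenP; exists (s b`_i) => //; apply: map_f; rewrite mem_enum.
pose deg (p : 'I_(size S) * 'I_(\dim {:V})) := tnth (in_tuple S) p.1.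
exists ('I_(size S) * 'I_(\dim {:V}))%type.
exists (fun p => component grV (deg p) b`_p.2).
exists (fun p v => coord b p.2 (component grV (deg p) v)), deg.
split.
- by move=> p c x y; rewrite lc linearP.
- move=> v; rewrite {1}[v]hS big_tnth.
  rewrite -(pair_big predT predT (fun d i =>
    coord b i (component grV (tnth (in_tuple S) d) v) *:
      component grV (tnth (in_tuple S) d) b`_i)) /=.
  apply: eq_bigr => d _; set D := tnth _ _; set v' := component grV D v.
  have {1}-> : v' = component grV D v'.
    by rewrite (component_id grV (e := D)) ?eqxx //; exact: (component_homog grV).
  rewrite {1}(coord_vbasis (memvf v')) -/b component_sum.
  by apply: eq_bigr => i _; rewrite (linZ (lc D)).
- by move=> p; exact: (component_homog grV).
- move=> d p v hv dp; rewrite (component_id grV _ hv).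
  by rewrite eq_sym (negPf dp) linear0.
Qed.

(** * Positivity of the weights of the polynomial variables *)

Section Weights.
Context (k : fieldType) (A : pzAlgType k) (degA : int -> A -> Prop).
Context (grA : graded_alg degA).
Context (n : nat) (iota : alghom {mpoly k[n]} A) (iota_inj : injective iota).

Lemma degAX d a m : degA d a -> degA (d *+ m) (a ^+ m).
Proof.
move=> h; elim: m => [|m IH]; first by rewrite mulr0n expr0; exact: graded_alg1.
by rewrite mulrS exprS; exact: (graded_algM grA).
Qed.

(** A variable of degree 0 would put all its powers in degree 0; they are linearly
    independent, and that part of A is finite dimensional. *)
Lemma var_weight_neq0 i : @fin_dim k A (degA 0) -> ~ degA 0 (iota 'X_i).
Proof.
move=> [m [e he]] h0.
have /choice[c hc] : forall j : 'I_m.+1, exists c : 'I_m -> k,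
    iota ('X_i ^+ j) = \sum_l c l *: e l.
  by move=> j; apply: he; rewrite rmorphXn /= -(mul0rn _ j); exact: degAX.
pose M := \matrix_(j < m.+1, l < m) c j l.
(* m + 1 powers expressed by m vectors satisfy a nontrivial relation *)
have : kermx M != 0.
  rewrite -mxrank_eq0 mxrank_ker subn_eq0 -ltnNge ltnS; exact: rank_leq_col.
case/rowV0Pn => v /sub_kermxP vM /negP; apply; apply/eqP/rowP => j.
have : \sum_j v 0 j *: 'X_i ^+ (j : nat) = 0 :> {mpoly k[n]}.
  apply: iota_inj; rewrite linear_sum linear0 /=.
  under eq_bigr => j' _ do rewrite linearZ /= hc scaler_sumr.
  rewrite exchange_big big1 //= => l _.
  under eq_bigr => j' _ do rewrite scalerA.
  rewrite -scaler_suml; have := congr1 (fun N : 'rV_m => N 0 l) vM.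
  rewrite !mxE => vMl; rewrite (eq_bigr (fun j' => v 0 j' * M j' l)) ?vMl ?scale0r //.
  by move=> j' _; rewrite mxE.
move/(congr1 (mcoeff (U_(i) *+ j)%MM)); rewrite mcoeff0 raddf_sum /= (bigD1 j) //=.
rewrite big1 => [|j' jj']; last first.
  rewrite mcoeffZ mpolyXn mcoeffX; case: eqP => [/mnmP/(_ i)|_]; last by rewrite mulr0.
  rewrite !mulmnE mnm1E eqxx !mul1n => /val_inj ejj.
  by rewrite ejj eqxx in jj'.
by rewrite mcoeffZ mpolyXn mcoeffX eqxx mulr1 addr0 mxE.
Qed.

(** The inequality is what makes the graded pieces of R finite dimensional: the
    monomials of a given weight have bounded degree. *)
Lemma monomial_weights :
  (forall (d : int) (a : A), d < 0 -> degA d a -> a = 0) ->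
  @fin_dim k A (degA 0) ->
  (forall i : 'I_n, exists d : int, degA d (iota 'X_i)) ->
  exists wt : 'X_{1..n} -> int,
    [/\ forall m, (mdeg m)%:Z <= wt m,
        forall m, degR degA iota (wt m) 'X_[m]
      & forall d p m, degR degA iota d p -> wt m != d -> p@_m = 0].
Proof.
move=> nneg fd /choice[w hw].
have w1 i : 1 <= w i.
  rewrite -gtz0_ge1 lt_neqAle; apply/andP; split.
    by apply/eqP => w0; apply: (@var_weight_neq0 i fd); rewrite w0; exact: hw.
  rewrite leNgt; apply/negP => wi.
  have /iota_inj/(congr1 (mcoeff U_(i)%MM)) : iota 'X_i = iota 0.
    by rewrite (nneg _ _ wi (hw i)) linear0.
  by rewrite mcoeffX eqxx mcoeff0 => /eqP; rewrite oner_eq0.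
pose wt (m : 'X_{1..n}) := \sum_i w i *+ m i.
have degX m : degR degA iota (wt m) 'X_[m].
  rewrite /degR mpolyXE_id rmorph_prod /wt.
  apply: (big_rec2 (fun (x : A) (d : int) => degA d x)); first exact: graded_alg1.
  move=> i y x _ IH; apply: (graded_algM grA) => //.
  by rewrite rmorphXn; apply: degAX; exact: hw.
exists wt; split=> // [m|d p m hp md].
  rewrite mdegE (big_morph Posz PoszD (erefl _)) ler_sum // => i _.
  by rewrite -[(m i)%:Z]natz lerMn2r w1 orbT.
have gr := graded_alg_grading grA.
have : component gr (wt m) (iota p) = 0.
  by rewrite (component_id gr _ hp) (negPf md).
rewrite {1}[p]mpolyE linear_sum /= component_sum.
rewrite (eq_bigr (fun m' => iota (if wt m == wt m' then p@_m' *: 'X_[m'] else 0))).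
  rewrite -linear_sum => e; have /iota_inj := etrans e (esym (linear0 iota)).
  move/(congr1 (mcoeff m)).
  rewrite mcoeff0 raddf_sum /=; have [mp|mp] := boolP (m \in msupp p); last first.
    by move=> _; exact: memN_msupp_eq0.
  rewrite (big_rem m) //= eqxx mcoeffZ mcoeffX eqxx mulr1 big_seq big1 ?addr0 //.
  move=> m' mm'; case: ifP => _; last exact: mcoeff0.
  have: m' != m by apply: contraTneq mm' => ->; rewrite mem_rem_uniqF.
  by rewrite mcoeffZ mcoeffX => /negPf ->; rewrite mulr0.
move=> m' _; have h : degA (wt m') (iota (p@_m' *: 'X_[m'])).
  by rewrite linearZ; apply: (graded_algZ grA); exact: degX.
by rewrite (component_id gr _ h); case: ifP => // _; rewrite linear0.
Qed.
End Weights.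

(** * Coefficients of elements of V (x) R_T *)

Lemma sum_bmultinom_widen (n b c : nat) (U : nmodType) (F : 'X_{1..n} -> U) :
  (b <= c)%N -> (forall m, (b <= mdeg m)%N -> F m = 0) ->
  \sum_(m : 'X_{1..n < c}) F m = \sum_(m : 'X_{1..n < b}) F m.
Proof.
move=> bc F0.
have mem_val a (m : 'X_{1..n}) :
    (m \in [seq bmnm i | i : 'X_{1..n < a}]) = (mdeg m < a)%N.
  apply/imageP/idP => [[i _ ->]|ma]; first exact: bmdeg.
  by exists (BMultinom ma).
have uval a : uniq [seq bmnm i | i : 'X_{1..n < a}].
  by rewrite map_inj_uniq ?enum_uniq //; exact: val_inj.
have sum_val a :
    \sum_(m : 'X_{1..n < a}) F m = \sum_(m <- [seq bmnm i | i : 'X_{1..n < a}]) F m.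
  by rewrite big_map big_enum.
rewrite !sum_val (bigID (fun m => mdeg m < b)%N) /=.
rewrite [X in _ + X]big1 ?addr0 => [|m]; last by rewrite -leqNgt; exact: F0.
rewrite -big_filter; apply/perm_big/uniq_perm; rewrite ?filter_uniq //.
move=> m; rewrite mem_filter !mem_val; apply: andb_idr => mb; exact: leq_trans bc.
Qed.

Lemma lin_sum (k : pzRingType) (U W : lmodType k) (f : U -> W) (lf : linear f)
    (I : Type) (r : seq I) (Q : pred I) (F : I -> U) :
  f (\sum_(i <- r | Q i) F i) = \sum_(i <- r | Q i) f (F i).
Proof. by apply: (big_morph f); [exact: linD | exact: lin0]. Qed.

Section Coefficients.
Context (k : fieldType) (n : nat) (V : lmodType k).
Context (P : finType) (e : P -> V) (phi : P -> V -> k).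
Hypothesis phi_linear : forall p, linear (phi p : V -> k^o).
Hypothesis frameE : forall v, v = \sum_p phi p v *: e p.

Local Notation R := {mpoly k[n]}.
Local Notation WT := (WT n V).
Local Notation RT := (RT n).

Section Over.
Variable T : comPzAlgType k.

Definition coefR (m : 'X_{1..n}) : RT T -> T :=
  tens_lift (fun (t : T) (p : R) => p@_m *: t).
Fact coefR_bilin m : bilin (fun (t : T) (p : R) => p@_m *: t).
Proof.
split=> [t|p] c x y /=; first by rewrite mcoeffD mcoeffZ scalerDl scalerA.
by rewrite scalerDr !scalerA mulrC.
Qed.
Lemma coefR_linear m : linear (coefR m).
Proof. exact: tens_lift_linear (coefR_bilin m). Qed.
Lemma coefR_pure m t p : coefR m (pure t p) = p@_m *: t.
Proof. exact: tens_lift_pure (coefR_bilin m) t p. Qed.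

Definition coefW (q : P) (m : 'X_{1..n}) : WT T -> T :=
  tens_lift (fun (v : V) (s : RT T) => phi q v *: coefR m s).
Fact coefW_bilin q m : bilin (fun (v : V) (s : RT T) => phi q v *: coefR m s).
Proof.
split=> [v|s] c x y /=.
  by rewrite coefR_linear scalerDr !scalerA mulrC.
by rewrite phi_linear scalerDl scalerA.
Qed.
Lemma coefW_linear q m : linear (coefW q m : tens V (RT T) -> T).
Proof. exact: tens_lift_linear (coefW_bilin q m). Qed.
Lemma coefWD q m w w' : coefW q m (w + w') = coefW q m w + coefW q m w'.
Proof. exact: linD (coefW_linear q m) w w'. Qed.
Lemma coefW0 q m : coefW q m 0 = 0.
Proof. exact: lin0 (coefW_linear q m). Qed.
Lemma coefW_pure q m v s : coefW q m (epure v s) = phi q v *: coefR m s.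
Proof. exact: tens_lift_pure (coefW_bilin q m) v s. Qed.

Definition expandR (b : nat) (s : RT T) : RT T :=
  \sum_(m : 'X_{1..n < b}) pure (coefR m s) 'X_[m].
Lemma expandRP s : exists b, forall c, (b <= c)%N -> s = expandR c s.
Proof.
have bp := pure_bilin T R.
elim/tens_ind: s => [|x y [b hb] [b' hb']|t p].
- exists 0%N => c _; rewrite /expandR big1 // => m _.
  by rewrite (lin0 (coefR_linear m)) (bilin0l bp).
- exists (maxn b b') => c; rewrite geq_max => /andP[bc bc'].
  rewrite {1}(hb c bc) {1}(hb' c bc') -big_split; apply: eq_bigr => m _ /=.
  by rewrite (linD (coefR_linear m)) (bilinDl bp).
- exists (msize p) => c pc; rewrite {1}(mpolywE pc) (lin_sum (bp.1 t)).
  by apply: eq_bigr => m _; rewrite coefR_pure (bilinZl bp) (bilinZr bp).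
Qed.

Definition expandW (b : nat) (w : WT T) : WT T :=
  \sum_q \sum_(m : 'X_{1..n < b}) epure (e q) (pure (coefW q m w) 'X_[m]).
Lemma expandWP w : exists b, forall c, (b <= c)%N -> w = expandW c w.
Proof.
have bp := pure_bilin T R; have bw := pure_bilin V (RT T).
elim/baseExt_ind: w => [|x y [b hb] [b' hb']|v s].
- exists 0%N => c _; rewrite /expandW big1 // => q _; rewrite big1 // => m _.
  by rewrite coefW0 (bilin0l bp) /epure (bilin0r bw).
- exists (maxn b b') => c; rewrite geq_max => /andP[bc bc'].
  rewrite {1}(hb c bc) {1}(hb' c bc') -big_split; apply: eq_bigr => q _ /=.
  rewrite -big_split; apply: eq_bigr => m _ /=.
  by rewrite coefWD (bilinDl bp) /epure (bilinDr bw).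
- have [b hb] := expandRP s; exists b => c bc.
  rewrite {1}/epure {1}[v]frameE {1}(hb c bc) (lin_sum (bw.2 _)).
  apply: eq_bigr => q _; rewrite (lin_sum (bw.1 _)); apply: eq_bigr => m _.
  by rewrite coefW_pure /epure (bilinZl bw) (bilinZl bp) (bilinZr bw).
Qed.

Lemma coefW_inj w w' : (forall q m, coefW q m w = coefW q m w') -> w = w'.
Proof.
move=> h; have [b hb] := expandWP w; have [b' hb'] := expandWP w'.
rewrite (hb (maxn b b')) ?leq_maxl // (hb' (maxn b b')) ?leq_maxr //.
by apply: eq_bigr => q _; apply: eq_bigr => m _; rewrite h.
Qed.

(** The family e may be dependent, so the right-hand side is not determined by
    comparing coefficients; it is obtained by discarding zero terms from a longer
    expansion. *)
Lemma expandW_bounded b w :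
  (forall q m, (b <= mdeg m)%N -> coefW q m w = 0) -> w = expandW b w.
Proof.
move=> h; have [c hc] := expandWP w.
rewrite {1}(hc (maxn b c)) ?leq_maxr //; apply: eq_bigr => q _.
rewrite (sum_bmultinom_widen (b := b)
  (F := fun m => epure (e q) (pure (coefW q m w) 'X_[m]))) ?leq_maxl // => m bm.
rewrite h // (bilin0l (pure_bilin T R)) /epure.
exact: (bilin0r (pure_bilin V (RT T))).
Qed.
End Over.

Section Naturality.
Variables (T T' : comPzAlgType k) (f : alghom T T').

Lemma coefR_nat m s : coefR m (Rf n f s) = f (coefR m s).
Proof.
have lf := alghom_lin f; have lR := alghom_lin (Rf n f).
elim/tens_ind: s => [|x y hx hy|t p].
- by rewrite (lin0 lR) !(lin0 (coefR_linear m)) (lin0 lf).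
- by rewrite (linD lR) !(linD (coefR_linear m)) hx hy (linD lf).
- by rewrite /Rf /= tens_map_pure // !coefR_pure (linZ lf).
Qed.

Lemma coefW_nat q m w : coefW q m (Wf f w) = f (coefW q m w).
Proof.
have lf := alghom_lin f.
elim/baseExt_ind: w => [|x y hx hy|v s].
- by rewrite Wf0 !coefW0 (lin0 lf).
- by rewrite WfD !coefWD hx hy (linD lf).
- by rewrite Wf_pure !coefW_pure coefR_nat (linZ lf).
Qed.
End Naturality.

Section Degrees.
Context (A : pzAlgType k) (degA : int -> A -> Prop) (iota : alghom R A).
Context (degV : int -> V -> Prop).
Context (dv : P -> int) (wt : 'X_{1..n} -> int).
Hypothesis frame_deg : forall p, degV (dv p) (e p).
Hypothesis phi_deg : forall d p v, degV d v -> d != dv p -> phi p v = 0.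
Hypothesis mon_deg : forall m, degR degA iota (wt m) 'X_[m].
Hypothesis mcoeff_deg : forall d (p : R) m, degR degA iota d p -> wt m != d -> p@_m = 0.

(** Turns membership in a graded piece into the vanishing of certain coefficients, a
    condition that is natural in T and can be tested at points. *)
Lemma degWT_coef (T : comPzAlgType k) d (w : WT T) :
  degWT degA iota degV d w <-> forall q m, dv q + wt m != d -> coefW q m w = 0.
Proof.
split=> [h q m dqm|h].
  apply: (tens_deg_lift (coefW_bilin T q m) (K := fun t => t = 0)) h => //.
    by move=> x y -> ->; rewrite addr0.
  move=> i j v s hv hs eij.
  have [ei|ei] := eqVneq i (dv q); last first.
    by rewrite (phi_deg hv ei) scale0r.
  suff -> : coefR m s = 0 by rewrite scaler0.
  apply: (tens_deg_lift (coefR_bilin T m) (K := fun t => t = 0)) hs => //.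
    by move=> x y -> ->; rewrite addr0.
  move=> i' j' t p [->|->] hp ej; last by rewrite scaler0.
  rewrite (mcoeff_deg hp) ?scale0r //; apply: contra dqm => /eqP ->.
  by rewrite -ei -eij -ej add0r.
have [b hb] := expandWP w; rewrite (hb b) // /expandW.
apply: (big_ind (degWT degA iota degV d)) => [|x y hx hy|q _].
- exact: tens_deg0.
- exact: tens_degD.
apply: (big_ind (degWT degA iota degV d)) => [|x y hx hy|m _].
- exact: tens_deg0.
- exact: tens_degD.
have [<-|dqm] := eqVneq (dv q + wt m) d.
  rewrite -[wt m]add0r; apply: tens_deg_pure => //; apply: tens_deg_pure => //.
  by left.
rewrite h // (bilin0l (pure_bilin T R)) /epure.
rewrite [X in degWT _ _ _ _ X](bilin0r (pure_bilin V (RT T))); exact: tens_deg0.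
Qed.
End Degrees.
End Coefficients.

(** * Functors given by finitely many graded operators *)

(** The common shape of the two functors at hand: a point over T is determined by
    finitely many R_T-linear operators on V (x) R_T, each of a fixed degree. *)
Section Operators.
Context (k : fieldType) (A : pzAlgType k) (degA : int -> A -> Prop).
Context (grA : graded_alg degA).
Context (n : nat) (iota : alghom {mpoly k[n]} A).
Context (V : lmodType k) (degV : int -> V -> Prop).
Context (P : finType) (e : P -> V) (phi : P -> V -> k) (dv : P -> int).
Context (wt : 'X_{1..n} -> int).
Hypothesis phi_linear : forall p, linear (phi p : V -> k^o).
Hypothesis frameE : forall v, v = \sum_p phi p v *: e p.
Hypothesis frame_deg : forall p, degV (dv p) (e p).
Hypothesis phi_deg : forall d p v, degV d v -> d != dv p -> phi p v = 0.
Hypothesis wt_ge : forall m, (mdeg m)%:Z <= wt m.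
Hypothesis mon_deg : forall m, degR degA iota (wt m) 'X_[m].
Hypothesis mcoeff_deg : forall d (p : {mpoly k[n]}) m,
  degR degA iota d p -> wt m != d -> p@_m = 0.

Local Notation WT := (WT n V).
Local Notation RT := (RT n).
Local Notation degWT := (degWT degA iota degV).
Local Notation coefW := (coefW phi).
Local Notation frame1 p := (epure (e p) 1).

Context (F : algFunctor k) (L : finType) (delta : L -> int).
Variable op : forall T : comPzAlgType k, F T -> L -> WT T -> WT T.
Hypothesis op_linear : forall T (x : F T) l, linear (op x l).
Hypothesis op_deg : forall T (x : F T) l d w,
  degWT d w -> degWT (delta l + d) (op x l w).
Hypothesis op_nat : forall (T T' : comPzAlgType k) (f : alghom T T') (x : F T) l w,
  op (fmap f x) l (Wf f w) = Wf f (op x l w).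
Hypothesis op_inj : forall T (x y : F T), (forall l w, op x l w = op y l w) -> x = y.

Lemma frame_linear_eq (T : comPzAlgType k) (N : lmodType (RT T)) (f g : WT T -> N) :
  linear f -> linear g -> (forall p, f (frame1 p) = g (frame1 p)) -> f =1 g.
Proof.
move=> lf lg fg; apply: baseExt_linear_eq => // v.
rewrite [v]frameE /epure (lin_sum ((pure_bilin V (RT T)).2 1)).
rewrite (lin_sum lf) (lin_sum lg); apply: eq_bigr => p _.
by rewrite -/(epure _ _) epureZ (linZ lf) (linZ lg) fg.
Qed.

(** An operator of degree [delta l] sends [e p] to degree [delta l + dv p], where only
    finitely many monomials occur, because weights dominate degrees. *)
Lemma degree_bound : exists M : nat, forall l p q m,
  (M <= mdeg m)%N -> dv q + wt m != delta l + dv p.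
Proof.
pose gap (j : L * P * P) : int := delta j.1.1 + dv j.1.2 - dv j.2.
exists (\max_j absz (gap j)).+1 => l p q m Mm; apply/eqP => E.
have wtE : wt m = gap (l, p, q) by rewrite /gap /= -E addrC addKr.
have : (mdeg m <= absz (gap (l, p, q)))%N.
  by rewrite -lez_nat abszE -wtE (le_trans (wt_ge m)) // ler_norm.
rewrite leqNgt => /negP; apply; apply: leq_trans Mm.
by rewrite ltnS (leq_bigmax (l, p, q)).
Qed.

Section Bounded.
Variable M : nat.
Hypothesis hM : forall l p q m, (M <= mdeg m)%N -> dv q + wt m != delta l + dv p.

(** Entries of the matrices of the operators with respect to the frame; by the choice
    of M no monomial is lost. *)
Definition matrix_coord (T : comPzAlgType k) (x : F T)
    (j : L * P * P * 'X_{1..n < M}) : T :=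
  let: (l, p, q, m) := j in coefW q m (op x l (frame1 p)).

Lemma Wf_frame1 (T T' : comPzAlgType k) (f : alghom T T') p :
  Wf f (frame1 p) = frame1 p :> WT T'.
Proof. by rewrite Wf_pure rmorph1. Qed.

Fact matrix_coord_nat (T T' : comPzAlgType k) (f : alghom T T') (x : F T) j :
  matrix_coord (fmap f x) j = f (matrix_coord x j).
Proof.
case: j => [[[l p] q] m] /=; rewrite -(Wf_frame1 f) op_nat.
exact: (coefW_nat phi_linear).
Qed.

Lemma op_frame1 (T : comPzAlgType k) (x : F T) l p :
  op x l (frame1 p) = \sum_q \sum_(m : 'X_{1..n < M})
    epure (e q) (pure (matrix_coord x (l, p, q, m)) 'X_[m]).
Proof.
apply: (expandW_bounded phi_linear frameE) => q m Mm.
suff : degWT (delta l + dv p) (op x l (frame1 p)).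
  move/(degWT_coef phi_linear frameE frame_deg phi_deg mon_deg mcoeff_deg); apply.
  exact: hM.
apply: op_deg; exact: degWT_pure1.
Qed.

Local Notation B := (coord_alg matrix_coord).
Local Notation pt := (@coord_pt k F _ matrix_coord _).

Lemma matrix_coord_inj (T : comPzAlgType k) : injective (@matrix_coord T).
Proof.
move=> x y exy; apply: op_inj => l; apply: frame_linear_eq => [||p].
- exact: op_linear.
- exact: op_linear.
- by rewrite !op_frame1 exy.
Qed.

Lemma points_separate (w w' : WT B) :
  (forall T (x : F T), Wf (pt x) w = Wf (pt x) w') -> w = w'.
Proof.
move=> h; apply: (coefW_inj phi_linear frameE) => q m.
apply: coord_pt_separates => T x.
by rewrite -!(coefW_nat phi_linear) h.
Qed.

Lemma points_degWT d (w : WT B) :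
  (forall T (x : F T), degWT d (Wf (pt x) w)) -> degWT d w.
Proof.
move=> h.
apply/(degWT_coef phi_linear frameE frame_deg phi_deg mon_deg mcoeff_deg) => q m dqm.
apply: coord_pt_separates => T x; rewrite -(coefW_nat phi_linear) raddf0.
have /(degWT_coef phi_linear frameE frame_deg phi_deg mon_deg mcoeff_deg) := h T x.
exact.
Qed.

(** Every vector of V (x) R_B can be acted on: the vectors whose images at all points
    come from one vector over B form a submodule, and it contains the frame, where
    the matrix with the coordinate variables as entries gives the result. *)
Lemma universal_operators : exists uop : L -> WT B -> WT B,
  forall T (x : F T) l w, Wf (pt x) (uop l w) = op x l (Wf (pt x) w).
Proof.
suff h l w : exists w', forall T (x : F T), Wf (pt x) w' = op x l (Wf (pt x) w).
  have /choice[uop huop] : forall lw : L * WT B, exists w', forall T (x : F T),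
      Wf (pt x) w' = op x lw.1 (Wf (pt x) lw.2) by move=> lw; exact: h.
  by exists (fun l w => uop (l, w)) => T x l w; rewrite huop.
pose K w := exists w', forall T (x : F T), Wf (pt x) w' = op x l (Wf (pt x) w).
rewrite -/(K w).
have K0 : K 0 by exists 0 => T x; rewrite Wf0 (lin0 (op_linear x l)).
have KD u v : K u -> K v -> K (u + v).
  move=> [u' hu] [v' hv]; exists (u' + v') => T x.
  by rewrite !WfD hu hv (linD (op_linear x l)).
have KZ (s : RT B) v : K v -> K (s *: v).
  move=> [v' hv]; exists (s *: v') => T x.
  by rewrite !WfZ hv (linZ (op_linear x l)).
have Kframe p : K (frame1 p).
  exists (\sum_q \sum_(m : 'X_{1..n < M})
    epure (e q) (pure (coord_var matrix_coord (l, p, q, m)) 'X_[m])) => T x.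
  rewrite Wf_frame1 op_frame1.
  rewrite (big_morph _ (@WfD _ _ _ _ _ (pt x)) (@Wf0 _ _ _ _ _ (pt x))); apply: eq_bigr => q _.
  rewrite (big_morph _ (@WfD _ _ _ _ _ (pt x)) (@Wf0 _ _ _ _ _ (pt x))); apply: eq_bigr => m _.
  rewrite Wf_pure -(coord_pt_var matrix_coord); congr epure.
  exact: (tens_map_pure (alghom_lin (pt x))).
elim/baseExt_ind: w => // v s; rewrite scale_epure1; apply: (KZ).
rewrite [v]frameE /epure (lin_sum ((pure_bilin V (RT B)).2 1)).
apply: (big_ind K) => // p _; rewrite -/(epure _ _) epureZ; exact: KZ.
Qed.

Lemma matrix_coord_represents (u : F B) :
  (forall T (x : F T) l w, Wf (pt x) (op u l w) = op x l (Wf (pt x) w)) ->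
  represents (@coord_pt k F _ matrix_coord).
Proof.
move=> hu; apply: (coord_represents matrix_coord_nat (u := u)).
  exact: matrix_coord_inj.
move=> [[[l p] q] m]; apply: coord_pt_separates => T x.
rewrite coord_pt_var -[LHS](coefW_nat phi_linear (coord_pt matrix_coord x)).
by rewrite hu Wf_frame1.
Qed.
End Bounded.

(** The hypothesis asks that operators over an algebra B with a separating family of
    points, which specialise at each point to the operators of that point, come from a
    point over B. For conditions that are identities or bounds on degrees this is
    automatic, since these can be tested at the points. *)
Theorem operator_functor_representable :
  (forall (B : comPzAlgType k) (pt : forall T : comPzAlgType k, F T -> alghom B T)
      (uop : L -> WT B -> WT B),
    (forall w w' : WT B,
      (forall T (x : F T), Wf (pt T x) w = Wf (pt T x) w') -> w = w') ->
    (forall d (w : WT B), (forall T (x : F T), degWT d (Wf (pt T x) w)) -> degWT d w) ->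
    (forall T (x : F T) l w, Wf (pt T x) (uop l w) = op x l (Wf (pt T x) w)) ->
    exists u : F B, forall l w, op u l w = uop l w) ->
  exists (B : comPzAlgType k) (Phi : forall T : comPzAlgType k, F T -> alghom B T),
    fin_gen_alg B /\ represents Phi.
Proof.
move=> univ; have [M hM] := degree_bound.
have [uop huop] := universal_operators hM.
have [u hu] := univ _ _ uop (@points_separate M) (@points_degWT M) huop.
exists (coord_alg (@matrix_coord M)), (@coord_pt k F _ (@matrix_coord M)).
split; first exact: coord_alg_fin_gen.
by apply: (matrix_coord_represents hM (u := u)) => T x l w; rewrite hu huop.
Qed.

End Operators.

(** * Module structures and graded automorphisms *)

Section Functors.
Context (k : fieldType) (A : pzAlgType k) (degA : int -> A -> Prop).
Context (grA : graded_alg degA).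
Context (n : nat) (iota : alghom {mpoly k[n]} A).
Context (iotaC : forall p : {mpoly k[n]}, central (iota p)).
Context (V : lmodType k) (degV : int -> V -> Prop).

Local Notation R := {mpoly k[n]}.
Local Notation WT := (WT n V).
Local Notation RT := (RT n).
Local Notation degWT := (degWT degA iota degV).
Local Notation X := (Rep degV grA iotaC).
Local Notation G := (GV iota degV grA).

(** Compatibility with base change is the only point that is not formal; it follows
    from the uniqueness of the base change of a module structure. *)
Lemma rep_act_group_action : group_action (G := G) (F := X) rep_act.
Proof.
split=> [T x|T g h x|T T' f g x]; try exact: rep_eq.
have [lg _ lg' _ _ _] := svalP g.
apply: rep_eq => a w; symmetry; move: a w.
apply: (bc_action_unique iotaC (svalP (rep_act T g x))) => [|a w].
  exact: (svalP (rep_act T' (fmap f g) (fmap f x))).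
rewrite /= bc_Wf // (bc_action_Wf iotaC f (svalP x)).
by rewrite bc_Wf.
Qed.

Lemma pointwise_linear (F : algFunctor k) (B : comPzAlgType k)
    (pt : forall T : comPzAlgType k, F T -> alghom B T)
    (f : WT B -> WT B) (g : forall T, F T -> WT T -> WT T) :
  (forall w w' : WT B, (forall T (x : F T), Wf (pt T x) w = Wf (pt T x) w') -> w = w') ->
  (forall T (x : F T) w, Wf (pt T x) (f w) = g T x (Wf (pt T x) w)) ->
  (forall T (x : F T), linear (g T x)) -> linear f.
Proof.
move=> separated fg lg r u v; apply: separated => T x.
by rewrite fg !WfD !WfZ !fg lg.
Qed.

(** The inverse is recorded along with the automorphism, so that invertibility becomes
    a pair of identities between operators. *)
Definition aut_op (T : comPzAlgType k) (g : G T) (b : bool) : WT T -> WT T :=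
  if b then (sval g).1 else (sval g).2.

Lemma aut_op_linear T (g : G T) b : linear (aut_op g b).
Proof. by have [? _ ? _ _ _] := svalP g; case: b. Qed.
Lemma aut_op_deg T (g : G T) (b : bool) d w : degWT d w -> degWT (0 + d) (aut_op g b w).
Proof. by rewrite add0r; have [_ h _ h' _ _] := svalP g; case: b => /=; auto. Qed.
Lemma aut_op_nat (T T' : comPzAlgType k) (f : alghom T T') (g : G T) b w :
  aut_op (fmap f g) b (Wf f w) = Wf f (aut_op g b w).
Proof. by have [? _ ? _ _ _] := svalP g; case: b; exact: bc_Wf. Qed.
Lemma aut_op_inj T (g h : G T) : (forall b w, aut_op g b w = aut_op h b w) -> g = h.
Proof. by move=> e; apply: gaut_eq => w; exact: (e true). Qed.

Lemma aut_op_universal (B : comPzAlgType k)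
    (pt : forall T : comPzAlgType k, G T -> alghom B T) (uop : bool -> WT B -> WT B) :
  (forall w w' : WT B, (forall T (x : G T), Wf (pt T x) w = Wf (pt T x) w') -> w = w') ->
  (forall d (w : WT B), (forall T (x : G T), degWT d (Wf (pt T x) w)) -> degWT d w) ->
  (forall T (x : G T) b w, Wf (pt T x) (uop b w) = aut_op x b (Wf (pt T x) w)) ->
  exists u : G B, forall b w, aut_op u b w = uop b w.
Proof.
move=> sep sepdeg huop.
have lin b : linear (uop b).
  apply: (pointwise_linear sep (g := fun T x => @aut_op T x b)) => [T x w|T x].
    exact: huop.
  exact: aut_op_linear.
have deg b d w : degWT d w -> degWT d (uop b w).
  move=> hw; apply: sepdeg => T x; rewrite huop -[d]add0r.
  apply: aut_op_deg; exact: degWfP.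
have inv b w : uop (~~ b) (uop b w) = w.
  apply: sep => T x; rewrite !huop; have [_ _ _ _ h h'] := svalP x.
  by case: b; rewrite /aut_op /=; [exact: h | exact: h'].
have hu : graded_aut degA iota degV (uop true, uop false).
  split=> /=; [exact: lin|exact: deg|exact: lin|exact: deg|exact: (inv true)|].
  exact: (inv false).
by exists (exist _ _ hu) => -[] w.
Qed.

Section Generators.
Context (J : finType) (gen : J -> A) (dgen : J -> int).
Hypothesis gen_deg : forall j, degA (dgen j) (gen j).
Hypothesis gen_span : forall a, exists r : J -> R, a = \sum_j iota (r j) * gen j.

(** A module structure is determined by the action of module generators of A over R,
    as that of R is prescribed. *)
Lemma fact_span (T : comPzAlgType k) (mu : AT A T -> WT T -> WT T) (a : A) (r : J -> R) w :
  framed_action degA iota degV mu -> a = \sum_j iota (r j) * gen j ->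
  mu (pure (1 : T) a) w =
    \sum_j (pure (1 : T) (r j) : RT T) *: mu (pure (1 : T) (gen j)) w.
Proof.
move=> hmu ->; rewrite (lin_sum ((pure_bilin T A).1 1)).
have mu0 : mu 0 w = 0.
  by have := fact_extends hmu 0 w; rewrite rmorph0 scale0r.
rewrite (big_morph (mu^~ w) (fun a b => factDl hmu a b w) mu0).
apply: eq_bigr => j _; rewrite -(fact_extends hmu) -(factM hmu); congr (mu _ w).
rewrite /iotaT /= tens_map_pure //; last exact: alghom_lin.
by rewrite pureM mulr1.
Qed.

Definition gen_op (T : comPzAlgType k) (x : X T) (j : J) : WT T -> WT T :=
  sval x (pure (1 : T) (gen j)).

Lemma gen_op_linear T (x : X T) j : linear (gen_op x j).
Proof. exact: (fact_linear iotaC (svalP x)). Qed.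
Lemma gen_op_deg T (x : X T) j d w : degWT d w -> degWT (dgen j + d) (gen_op x j w).
Proof.
apply: (fact_graded (svalP x)); rewrite -[dgen j]add0r; apply: tens_deg_pure => //.
by left.
Qed.
Lemma gen_op_nat (T T' : comPzAlgType k) (f : alghom T T') (x : X T) j w :
  gen_op (fmap f x) j (Wf f w) = Wf f (gen_op x j w).
Proof.
rewrite /gen_op -(bc_action_Wf iotaC _ (svalP x)) /=; congr (bc_action _ _ _ _).
by rewrite tens_map_pure ?rmorph1 //; exact: alghom_lin.
Qed.
Lemma gen_op_inj T (x y : X T) : (forall j w, gen_op x j w = gen_op y j w) -> x = y.
Proof.
move=> e; apply: rep_eq => a w.
elim/tens_ind: a => [|a b ha hb|t a].
- have e0 (z : X T) : sval z 0 w = 0.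
    by have := fact_extends (svalP z) 0 w; rewrite rmorph0 scale0r.
  by rewrite !e0.
- by rewrite !(factDl (svalP _)) ha hb.
- rewrite (fact_pure (svalP x)) (fact_pure (svalP y)); congr (_ *: _); have [r hr] := gen_span a.
  rewrite (fact_span w (svalP x) hr) (fact_span w (svalP y) hr); apply: eq_bigr => j _.
  by congr (_ *: _); exact: e.
Qed.

(** The universal module structure is not written down but chosen: a (x) w has a
    product with the right value at every point, by reduction to generators of A,
    and this value pins it down. The axioms are then inherited from the points. *)
Lemma gen_op_universal (B : comPzAlgType k)
    (pt : forall T : comPzAlgType k, X T -> alghom B T) (uop : J -> WT B -> WT B) :
  (forall w w' : WT B, (forall T (x : X T), Wf (pt T x) w = Wf (pt T x) w') -> w = w') ->
  (forall d (w : WT B), (forall T (x : X T), degWT d (Wf (pt T x) w)) -> degWT d w) ->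
  (forall T (x : X T) j w, Wf (pt T x) (uop j w) = gen_op x j (Wf (pt T x) w)) ->
  exists u : X B, forall j w, gen_op u j w = uop j w.
Proof.
move=> sep sepdeg huop.
have act_exists (a : AT A B) (w : WT B) : exists w' : WT B, forall T (x : X T),
    Wf (pt T x) w' = sval x (Af A (pt T x) a) (Wf (pt T x) w).
  elim/tens_ind: a => [|a a' [v hv] [v' hv']|t a].
  - exists 0 => T x; rewrite Wf0 (lin0 (alghom_lin (Af A (pt T x)))).
    by have := fact_extends (svalP x) 0 (Wf (pt T x) w); rewrite rmorph0 scale0r.
  - exists (v + v') => T x.
    by rewrite WfD hv hv' (linD (alghom_lin (Af A (pt T x)))) (factDl (svalP x)).
  - have [r hr] := gen_span a.
    exists ((pure t (1 : R) : RT B) *: \sum_j (pure (1 : B) (r j) : RT B) *: uop j w).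
    move=> T x; have lpt := alghom_lin (pt T x).
    rewrite WfZ (big_morph _ (@WfD _ _ _ _ _ (pt T x)) (@Wf0 _ _ _ _ _ (pt T x))).
    rewrite [Af A _ _]tens_map_pure // (fact_pure (svalP x)) (fact_span _ (svalP x) hr).
    rewrite [Rf n _ _]tens_map_pure //; congr (_ *: _); apply: eq_bigr => j _.
    by rewrite WfZ huop [Rf n _ _]tens_map_pure // rmorph1.
have /choice[mu' hmu'] : forall aw : AT A B * WT B, exists w' : WT B,
    forall T (x : X T), Wf (pt T x) w' = sval x (Af A (pt T x) aw.1) (Wf (pt T x) aw.2).
  by move=> aw; exact: act_exists.
pose mu a w := mu' (a, w).
have hmu T (x : X T) a w :
  Wf (pt T x) (mu a w) = sval x (Af A (pt T x) a) (Wf (pt T x) w) by exact: hmu'.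
have fmu : framed_action degA iota degV mu.
  split=> [w|a b w|a b w|a w w'|r w|d e a w ha hw].
  - by apply: sep => T x; rewrite hmu rmorph1 (fact1 (svalP x)).
  - by apply: sep => T x; rewrite !hmu rmorphM (factM (svalP x)).
  - by apply: sep => T x; rewrite WfD !hmu rmorphD (factDl (svalP x)).
  - by apply: sep => T x; rewrite !(hmu, WfD) (factDr (svalP x)).
  - apply: sep => T x; rewrite hmu WfZ -(fact_extends (svalP x)); congr (sval x _ _).
    have lpt := alghom_lin (pt T x); have li := alghom_lin iota.
    pose f1 := compalg (Af A (pt T x)) (iotaT iota B).
    pose f2 := compalg (iotaT iota T) (Rf n (pt T x)).
    apply: (tens_linear_eq (f := f1) (g := f2)) => [||t p]; try exact: alghom_lin.
    by rewrite /f1 /f2 /= /Af /Rf /iotaT /= !tens_map_pure.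
  - apply: sepdeg => T x; rewrite hmu; apply: (fact_graded (svalP x)); last exact: degWfP.
    move: a ha; apply: tens_deg_lift; [| exact: tens_deg0 | exact: tens_degD |].
      by apply: tens_map_bilin => //; exact: alghom_lin.
    move=> i j t a [->|->] ha <-; apply: tens_deg_pure => //; first by left.
    by right; rewrite (lin0 (alghom_lin (pt T x))).
exists (exist _ mu fmu) => j w; apply: sep => T x; rewrite hmu huop.
by rewrite [Af A _ _]tens_map_pure ?rmorph1 //; exact: alghom_lin.
Qed.
End Generators.
End Functors.

Theorem proposition2p2
  (k : closedFieldType)
  (A : pzAlgType k) (degA : int -> A -> Prop) (grA : graded_alg degA)
  (A_nneg : forall (d : int) (a : A), d < 0 -> degA d a -> a = 0)
  (A_finite_center : module_finite (@central A))
  (center_fin_gen : fin_gen_subalg (@central A))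
  (A0_fin_dim : @fin_dim k A (degA 0))
  (n : nat) (iota : alghom {mpoly k[n]} A)
  (iota_inj : injective iota)
  (iotaC : forall p : {mpoly k[n]}, central (iota p))
  (iota_homog : forall i : 'I_n, exists d : int, degA d (iota 'X_i))
  (A_finite_R : module_finite (fun a : A => exists p : {mpoly k[n]}, iota p = a))
  (V : vectType k) (degV : int -> {vspace V})
  (grV : grading (fun (d : int) (v : V) => v \in degV d)) :
  let X := Rep (fun (d : int) (v : V) => v \in degV d) grA iotaC in
  let G := GV iota (fun (d : int) (v : V) => v \in degV d) grA in
  exists (B : comPzAlgType k) (Phi : forall T : comPzAlgType k, X T -> alghom B T),
    [/\ fin_gen_alg B,
        represents Phi
      & exists (H : comPzAlgType k) (Psi : forall T : comPzAlgType k, G T -> alghom H T),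
        [/\ fin_gen_alg H,
            represents Psi,
            group_action (G := G) (F := X) rep_act
          & algebraic_action Psi Phi rep_act]].
Proof.
move=> X G.
have [P [e [phi [dv [phi_linear frameE frame_deg phi_deg]]]]] := homogeneous_frame grV.
have [wt [wt_ge mon_deg mcoeff_deg]] :=
  monomial_weights grA iota_inj A_nneg A0_fin_dim iota_homog.
have [J [gen [dgen [gen_deg gen_span]]]] :=
  homogeneous_generators (graded_alg_grading grA) A_finite_R.
have gen_spanR a : exists r : J -> {mpoly k[n]}, a = \sum_j iota (r j) * gen j.
  have [c [/choice[r hr] ->]] := gen_span a; exists r.
  by apply: eq_bigr => j _; rewrite hr.
have representable (F : algFunctor k) := operator_functor_representable grA
  phi_linear frameE frame_deg phi_deg wt_ge mon_deg mcoeff_deg (F := F).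
have [B [Phi [fgB rPhi]]] : exists (B : comPzAlgType k)
    (Phi : forall T : comPzAlgType k, X T -> alghom B T), fin_gen_alg B /\ represents Phi.
  apply: (representable X J dgen (fun T x j => gen_op gen x j)).
  - by move=> T x j; exact: gen_op_linear.
  - by move=> T x j d w; exact: gen_op_deg.
  - by move=> T T' f x j w; exact: gen_op_nat.
  - by move=> T x y; exact: gen_op_inj.
  - exact: gen_op_universal.
have [H [Psi [fgH rPsi]]] : exists (H : comPzAlgType k)
    (Psi : forall T : comPzAlgType k, G T -> alghom H T), fin_gen_alg H /\ represents Psi.
  apply: (representable G bool (fun=> 0) (fun T g b => aut_op g b)).
  - by move=> T g b; exact: aut_op_linear.
  - by move=> T g b d w; exact: aut_op_deg.
  - by move=> T T' f g b w; exact: aut_op_nat.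
  - by move=> T g h; exact: aut_op_inj.
  - exact: aut_op_universal.
have act := rep_act_group_action grA iotaC (fun d (v : V) => v \in degV d).
exists B, Phi; split=> //; exists H, Psi; split=> //.
exact: group_action_algebraic.
Qed.
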